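(* Let $s,\varepsilon\in(0,\infty)$, $r\in\mathbb N$ with $r>s$, $f\in\Lambda_s$, and assume the regularity $L$ of the Daubechies wavelet system satisfies $L\ge r-1$ and $L>s$. Then there exist constants $c\in(0,1)$, $m\in\mathbb N$ and $R\in(1,\infty)$ (where $m$ and $R$ may depend on $f$ and $\varepsilon$) such that for every $j\in\mathbb Z_+$, $$S_{r,j}(s,f,\varepsilon)\subset\bigcup_{i=j-m}^{j+m}\big[T^0_i(s,f,c\varepsilon)\big]_R,$$ with the convention $T^0_i(s,f,c\varepsilon):=\emptyset$ for $i<0$.
   Context: $\Delta_hf(x):=f(x+h/2)-f(x-h/2)$, $\Delta^{k+1}_h:=\Delta^k_h\Delta_h$, $\Delta_rf(x,y):=\sup_{|h|=y}|\Delta_h^rf(x)|$. $\Lambda_s$: bounded continuous $f$ with $\|f\|_{L^\infty}+\sup_{x,\,y\in(0,1]}\Delta_{\lfloor s\rfloor+1}f(x,y)/y^s<\infty$. $S_{r,j}(s,f,\varepsilon):=\{(x,y)\in\mathbb R^n\times(0,\infty):\Delta_rf(x,y)/y^s>\varepsilon,\ y\in(2^{-j-1},2^{-j}]\}$. $\mathcal D_j=\{2^{-j}(k+[0,1)^n):k\in\mathbb Z^n\}$, $\mathcal D=\bigcup_{j\ge0}\mathcal D_j$; $T(I):=I\times(\ell(I)/2,\ell(I)]$. Daubechies wavelet system of regularity $L$ ($\varphi,\psi_\ell\in C^L_c$, $\ell=1,\dots,2^n-1$, vanishing moments up to order $L$, $\{\varphi(\cdot-k)\}\cup\{2^{jn/2}\psi_\ell(2^j\cdot-k)\}$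 orthonormal basis of $L^2$), indexed by $\Omega=\{0\}\times\mathcal D_0\cup\{1,\dots,2^n-1\}\times\mathcal D$ with $\psi_{(0,k+[0,1)^n)}=\varphi(\cdot-k)$, $\psi_{(\ell,2^{-j}(k+[0,1)^n))}=2^{jn/2}\psi_\ell(2^j\cdot-k)$, $I_{(\ell,I)}=I$. $W^0_i(s,f,\varepsilon):=\{I\in\mathcal D_i:\max_{\omega\in\Omega:I_\omega=I}|\int f\psi_\omega|>\varepsilon|I|^{s/n+1/2}\}$, $T^0_i(s,f,\varepsilon):=\bigcup_{I\in W^0_i(s,f,\varepsilon)}T(I)$. Hyperbolic metric $\rho(\mathbf x,\mathbf y)=\operatorname{arccosh}(1+\frac{|\mathbf x-\mathbf y|^2}{2x_{n+1}y_{n+1}})$; $A_R:=\{\mathbf x:\inf_{\mathbf y\in A}\rho(\mathbf x,\mathbf y)<R\}$. *)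

(* Defs.v *)
From HB Require Import structures.
From mathcomp Require Import all_boot all_order all_algebra.
From mathcomp Require Import all_classical all_reals all_analysis.
Set Implicit Arguments. Unset Strict Implicit. Unset Printing Implicit Defensive.
Import Order.TTheory GRing.Theory Num.Theory.
Import numFieldNormedType.Exports.
Local Open Scope classical_set_scope.
Local Open Scope ring_scope.

Section Defs.
Variables (R : realType) (n : nat).
Local Notation pt := 'rV[R]_n.

Definition enorm (x : pt) : R := Num.sqrt (\sum_(i < n) x ord0 i ^+ 2).

Definition sdiff (h : pt) (g : pt -> R) : pt -> R :=
  fun x => g (x + 2^-1 *: h) - g (x - 2^-1 *: h).
Definition sdiffn (r : nat) (h : pt) (g : pt -> R) : pt -> R := iter r (sdiff h) g.

Definition DeltaR (r : nat) (f : pt -> R) (x : pt) (y : R) : R :=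
  sup [set `|sdiffn r h f x| | h in [set h : pt | enorm h = y]].

Definition bounded_fun (f : pt -> R) : Prop := exists M : R, forall x, `|f x| <= M.

Definition in_Lambda (s : R) (f : pt -> R) : Prop :=
  continuous f /\ bounded_fun f /\
  exists C : R, forall (x : pt) (y : R), 0 < y <= 1 ->
     DeltaR (Num.truncn s).+1 f x y / y `^ s <= C.

Definition Sset (r j : nat) (s : R) (f : pt -> R) (eps : R) : set (pt * R) :=
  [set X | 0 < X.2 /\ DeltaR r f X.1 X.2 / X.2 `^ s > eps /\
           (2 ^- j.+1 < X.2 <= 2 ^- j)].

Definition setc (x : pt) (k : nat) (t : R) : pt :=
  \row_(i < n) (if (i : nat) == k then t else x ord0 i).
Fixpoint iterint (k : nat) (g : pt -> R) (x : pt) : R :=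
  match k with
  | 0 => g x
  | k'.+1 => Rintegral lebesgue_measure setT (fun t => iterint k' g (setc x k' t))
  end.
Definition intRn (g : pt -> R) : R := iterint n g 0.

Definition compact_support (g : pt -> R) : Prop :=
  exists M : R, forall x, M < enorm x -> g x = 0.

Fixpoint CL (k : nat) (g : pt -> R) : Prop :=
  continuous g /\
  match k with
  | 0 => True
  | k'.+1 => forall i : 'I_n,
      (forall x, derivable g x (delta_mx ord0 i)) /\
      CL k' (fun x => 'D_(delta_mx ord0 i) g x)
  end.

(* wavelet indices: (l, j, k) ; l = 0 stands for phi(. - k) (j = 0),
   1 <= l <= 2^n - 1 for 2^{jn/2} psi_l(2^j . - k) ;  I_omega = 2^-j (k + [0,1)^n) *)
Definition windex := (nat * nat * 'rV[int]_n)%type.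
Definition Omega : set windex :=
  [set w | (w.1.1 = 0%N /\ w.1.2 = 0%N) \/ (1 <= w.1.1 <= 2 ^ n - 1)%N].

Definition intv (k : 'rV[int]_n) : pt := map_mx (fun z : int => z%:~R) k.

Definition wav (phi : pt -> R) (psi : nat -> pt -> R) (w : windex) : pt -> R :=
  let: (l, j, k) := w in
  if l == 0%N then fun x => phi (x - intv k)
  else fun x => 2 `^ ((j * n)%:R / 2) * psi l ((2 ^+ j) *: x - intv k).

Definition wcoef phi psi (g : pt -> R) (w : windex) : R :=
  intRn (fun x => g x * wav phi psi w x).

Definition daubechies (L : nat) (phi : pt -> R) (psi : nat -> pt -> R) : Prop :=
  [/\ CL L phi /\ compact_support phi,
      (forall l, (1 <= l <= 2 ^ n - 1)%N -> CL L (psi l) /\ compact_support (psi l)),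
      (forall l, (1 <= l <= 2 ^ n - 1)%N -> forall a : 'I_n -> nat,
          (\sum_(i < n) a i <= L)%N ->
          intRn (fun x => (\prod_(i < n) x ord0 i ^+ a i) * psi l x) = 0),
      (forall w w', Omega w -> Omega w' ->
          intRn (fun x => wav phi psi w x * wav phi psi w' x) =
          (if w == w' then 1 else 0))
    & (* completeness in L^2 (Parseval on the dense class C_c) *)
      (forall g : pt -> R, continuous g -> compact_support g ->
          (\esum_(w in Omega) ((wcoef phi psi g w) ^+ 2)%:E)%E =
          (intRn (fun x => g x ^+ 2))%:E)].

Definition cube (i : nat) (k : 'rV[int]_n) : set pt :=
  [set x | forall c : 'I_n, (k ord0 c)%:~R <= 2 ^+ i * x ord0 c < (k ord0 c)%:~R + 1].
Definition Tbox (i : nat) (k : 'rV[int]_n) : set (pt * R) :=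
  [set X | cube i k X.1 /\ 2 ^- i / 2 < X.2 <= 2 ^- i].

Definition W0 phi psi (i : nat) (s : R) (f : pt -> R) (eps : R) : set 'rV[int]_n :=
  [set k | exists l : nat, Omega (l, i, k) /\
     `|wcoef phi psi f (l, i, k)| > eps * (2 ^- (i * n)) `^ (s / n%:R + 2^-1)].
Definition T0 phi psi (i : int) (s : R) (f : pt -> R) (eps : R) : set (pt * R) :=
  match i with
  | Posz i' => [set X | exists2 k, W0 phi psi i' s f eps k & Tbox i' k X]
  | Negz _ => set0
  end.

(* hyperbolic metric on the upper half space, arccosh t = ln (t + sqrt(t^2-1)) *)
Definition arccosh (t : R) : R := ln (t + Num.sqrt (t ^+ 2 - 1)).
Definition hrho (X Y : pt * R) : R :=
  arccosh (1 + ((enorm (X.1 - Y.1)) ^+ 2 + (X.2 - Y.2) ^+ 2) / (2 * X.2 * Y.2)).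
Definition hnbhd (A : set (pt * R)) (Rr : R) : set (pt * R) :=
  [set X | 0 < X.2 /\ exists2 Y, A Y & hrho X Y < Rr].

End Defs.

(* Main.v *)
(** Write [f] as its wavelet series.  If [f] is in Lambda_s, a coefficient at scale
    2^-i, divided by the L^2 normalisation 2^(-in/2), is O(2^(-is)), whereas
    Delta_h^r of a wavelet of scale 2^-i is, relative to the size 2^(in/2) of the
    wavelet, O(min(1, (2^i |h|)^p)) with p = min(r, L) > s.  Hence, for |h| ~ 2^-j,
    the total contribution of scale i to Delta_h^r f(x) is O(2^(-js) t^|i-j|) for
    some t < 1: the scales with |i-j| > m are negligible for m large, and if every
    coefficient at the remaining scales whose wavelet meets the points
    x + (p - r/2) h is below c eps 2^(-i(s + n/2)), then |Delta_h^r f(x)| < eps |h|^s.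
    The cubes of these wavelets are at bounded hyperbolic distance from (x, |h|).

    The decay of the coefficients is obtained without polynomial approximation of
    [f].  Let A_t f be an average of the translates f(. + m 2^t u), 1 <= m <= k,
    against the probability density phi(u)^2, corrected so that f - A_t f is a mean
    of k-th differences of [f].  Telescoping A_t A_t f over t reduces the pairing of
    [f] with a wavelet to pairings of averages A_t g with g small, and there the
    average can be moved onto the wavelet, whose vanishing moments absorb the
    derivatives of phi^2. *)

Require Import Defs.
From HB Require Import structures.
From mathcomp Require Import all_boot all_order all_algebra.
From mathcomp Require Import all_classical all_reals all_analysis.
From mathcomp Require finmap.
From mathcomp Require Import ring lra.
Import Order.TTheory GRing.Theory Num.Theory.
Import numFieldNormedType.Exports.
Local Open Scope classical_set_scope.
Local Open Scope ring_scope.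
Set Implicit Arguments. Unset Strict Implicit. Unset Printing Implicit Defensive.

Lemma mul_div_addr1_le (R : realFieldType) (a e : R) :
  0 <= a -> 0 <= e -> a * (e / (a + 1)) <= e.
Proof.
move=> a0 e0; have a1 : 0 < a + 1 by rewrite ltr_wpDl.
by rewrite mulrCA ler_piMr// ler_pdivrMr// mul1r lerDl.
Qed.

Lemma le_sum_term (R : numDomainType) (I : finType) (F : I -> R) i :
  (forall j, 0 <= F j) -> F i <= \sum_j F j.
Proof. by move=> F0; rewrite (bigD1 i)//= lerDl sumr_ge0. Qed.

(** * Continuous functions supported in a ball *)

Section ContinuousBallSupport.
Context {R : realType} {V : normedModType R}.
Implicit Types (K : R) (f g : V -> R) (x y : V).

Definition Cc_ball K g : Prop := continuous g /\ forall x, K < `|x| -> g x = 0.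

Lemma Cc_ballW K K' g : K <= K' -> Cc_ball K g -> Cc_ball K' g.
Proof. by move=> KK [cg g0]; split => // x /(le_lt_trans KK); exact: g0. Qed.

Lemma Cc_ball0 K : Cc_ball K (fun=> 0).
Proof. by split => // x; exact: cvg_cst. Qed.

Lemma Cc_ballD K f g : Cc_ball K f -> Cc_ball K g ->
  Cc_ball K (fun x => f x + g x).
Proof.
move=> [cf f0] [cg g0]; split => [x|x Kx]; last by rewrite f0// g0// addr0.
by apply: cvgD; [exact: cf|exact: cg].
Qed.

Lemma Cc_ballMl K f g : continuous f -> Cc_ball K g ->
  Cc_ball K (fun x => f x * g x).
Proof.
move=> cf [cg g0]; split => [x|x Kx]; last by rewrite g0// mulr0.
by apply: cvgM; [exact: cf|exact: cg].
Qed.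

Lemma Cc_ballMr K f g : Cc_ball K f -> continuous g ->
  Cc_ball K (fun x => f x * g x).
Proof. by move=> cf cg; under eq_fun do rewrite mulrC; exact: Cc_ballMl. Qed.

Lemma Cc_ballX2 K g : Cc_ball K g -> Cc_ball K (fun x => g x ^+ 2).
Proof. by move=> cg; under eq_fun do rewrite expr2; exact: Cc_ballMl cg.1 cg. Qed.

Lemma Cc_ballZ K (c : R) g : Cc_ball K g -> Cc_ball K (fun x => c * g x).
Proof. by apply: Cc_ballMl => x; exact: cvg_cst. Qed.

Lemma Cc_ballN K g : Cc_ball K g -> Cc_ball K (fun x => - g x).
Proof. by move=> /(Cc_ballZ (-1)); under eq_fun do rewrite mulN1r. Qed.

Lemma Cc_ballB K f g : Cc_ball K f -> Cc_ball K g ->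
  Cc_ball K (fun x => f x - g x).
Proof. by move=> cf /Cc_ballN; exact: Cc_ballD. Qed.

Lemma Cc_ball_norm K g : Cc_ball K g -> Cc_ball K (fun x => `|g x|).
Proof.
move=> [cg g0]; split => [x|x Kx]; last by rewrite g0// normr0.
by apply: cvg_norm; exact: cg.
Qed.

Lemma Cc_ball_sum (I : eqType) (r : seq I) (F : I -> V -> R) K :
  (forall i, i \in r -> Cc_ball K (F i)) ->
  Cc_ball K (fun x => \sum_(i <- r) F i x).
Proof.
elim: r => [_|i r IH cF].
  by under eq_fun do rewrite big_nil; exact: Cc_ball0.
under eq_fun do rewrite big_cons.
apply: Cc_ballD; first by apply: cF; rewrite mem_head.
by apply: IH => j jr; apply: cF; rewrite in_cons jr orbT.
Qed.

Lemma dist_continuous g :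
  (forall x e, 0 < e -> exists2 d, 0 < d &
    forall y, `|x - y| <= d -> `|g x - g y| <= e) -> continuous g.
Proof.
move=> gd x; apply/cvgrPdist_le => e /(gd x)[d d0 dg].
by apply/nbhs_normP; exists d => //= y /ltW; exact: dg.
Qed.

Lemma continuous_cstM (c : R) g : continuous g -> continuous (fun x => c * g x).
Proof. by move=> cg x; apply: cvgM; [exact: cvg_cst|exact: cg]. Qed.

Lemma continuous_affine g (a : R) b :
  continuous g -> continuous (fun x => g (a *: x + b)).
Proof.
move=> cg x; apply: (@continuous_comp _ _ _ (fun x => a *: x + b) g); last exact: cg.
by apply: cvgD; [exact: scaler_continuous|exact: cvg_cst].
Qed.

Lemma continuous_translate g b : continuous g -> continuous (fun x => g (x + b)).
Proof. by move=> /(@continuous_affine g 1 b); under eq_fun do rewrite scale1r. Qed.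

Lemma Cc_ball_affine K g (a : R) b : a != 0 -> Cc_ball K g ->
  Cc_ball ((K + `|b|) / `|a|) (fun x => g (a *: x + b)).
Proof.
move=> a0 [cg g0]; split; first exact: continuous_affine.
move=> x; rewrite ltr_pdivrMr ?normr_gt0// mulrC -normrZ => Kax; apply: g0.
by have := ler_normB (a *: x + b) b; rewrite addrK; lra.
Qed.

Lemma Cc_ball_translate K g b : Cc_ball K g ->
  Cc_ball (K + `|b|) (fun x => g (x + b)).
Proof.
move=> /(@Cc_ball_affine K g 1 b (oner_neq0 R)); rewrite normr1 divr1.
by under eq_fun do rewrite scale1r.
Qed.

Definition balls_compact : Prop := forall K, compact [set x : V | `|x| <= K].

Hypothesis cV : balls_compact.

Lemma continuous_ball_bounded g K : continuous g ->
  exists2 B, 0 <= B & forall x, `|x| <= K -> `|g x| <= B.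
Proof.
move=> cg.
have /compact_bounded[M [Mreal MB]] :=
  continuous_compact (continuous_subspaceT cg) (@cV K).
exists (`|M| + 1) => // x xK.
by apply: MB; [have := ler_norm M; lra|exists x].
Qed.

Lemma Cc_ball_bounded K g : Cc_ball K g ->
  exists2 B, 0 <= B & forall x, `|g x| <= B.
Proof.
move=> [cg g0]; have [B B0 gB] := continuous_ball_bounded K cg.
exists B => // x; have [|xK] := leP `|x| K; first exact: gB.
by rewrite g0// normr0.
Qed.

Lemma continuous_ball_unif g K e : continuous g -> 0 < e ->
  exists2 d, 0 < d & forall x y, `|x| <= K -> `|x - y| <= d -> `|g x - g y| <= e.
Proof.
move=> cg e0; pose P (d : R) x := forall y, `|x - y| <= d -> `|g x - g y| <= e.
have /compact_near_coveringP : compact [set x : V | `|x| <= K] by exact: cV.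
move=> /(_ R (0 : R)^'+ P _)[].
  move=> x _; have /cvgrPdist_lt/(_ _ (divr_gt0 e0 (ltr0n R 2))) := cg x.
  move=> /nbhs_normP[d /= d0 dg]; have d2 : 0 < d / 2 by rewrite divr_gt0.
  exists ([set z | `|x - z| < d / 2], [set t | t < d / 2]) => /=.
    by split; [apply/nbhs_normP; exists (d / 2)|exact: nbhs_right_lt].
  move=> [z t] /= [xz td] y zy.
  rewrite -(subrKA (g x)); apply: le_trans (ler_normD _ _) _; rewrite (distrC (g z)).
  have : `|g x - g z| < e / 2 by apply: dg; rewrite /ball_/=; lra.
  suff : `|g x - g y| < e / 2 by lra.
  by apply: dg; rewrite /ball_/= -(subrKA z); apply: le_lt_trans (ler_normD _ _) _; lra.
move=> d /= d0 dP; have d2 : 0 < d / 2 by rewrite divr_gt0.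
exists (d / 2) => // x y xK; apply: dP => //=.
by rewrite sub0r normrN gtr0_norm// gtr_pMr// invf_lt1// ltr1n.
Qed.

Lemma Cc_ball_unif K g e : Cc_ball K g -> 0 < e ->
  exists2 d, 0 < d & forall x y, `|x - y| <= d -> `|g x - g y| <= e.
Proof.
move=> [cg g0] e0; have [d d0 dg] := continuous_ball_unif K cg e0.
exists d => // x y xy; have [xK|xK] := leP `|x| K; first exact: dg.
have [yK|yK] := leP `|y| K; last by rewrite g0// g0// subrr normr0 ltW.
by rewrite distrC; apply: dg; rewrite // distrC.
Qed.

End ContinuousBallSupport.

Arguments continuous_cstM {R V} c {g}.
Arguments continuous_affine {R V g} a b.
Arguments continuous_translate {R V g} b.

Lemma balls_compact_R (R : realType) : balls_compact (V := R).
Proof.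
move=> K; rewrite [X in compact X](_ : _ = `[- K, K]%classic).
  exact: segment_compact.
by apply/seteqP; split => x /=; rewrite in_itv/= ler_norml.
Qed.

Lemma balls_compact_rV (R : realType) n : balls_compact (V := 'rV[R]_n).
Proof.
move=> K; apply: bounded_closed_compact.
  by exists K; split; [exact: num_real|move=> M KM x /= xK; lra].
by apply: (preimage_closed _ (@closed_le R K)) => x _; exact: norm_continuous.
Qed.

Lemma balls_compact_prod (R : realType) (V W : normedModType R) :
  balls_compact (V := V) -> balls_compact (V := W) ->
  balls_compact (V := (V * W)%type).
Proof.
move=> cV cW K; have := compact_setX (cV K) (cW K).
congr compact; apply/seteqP; split => -[x y]; rewrite /= prod_normE/= ge_max.
  by move=> [-> ->].
by move=> /andP.
Qed.

(** * Integration on the line *)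

Section Integral1.
Context {R : realType}.
Local Notation mu := (@lebesgue_measure R).
Implicit Types (K M a b c e h : R) (f g : R -> R).

Definition int1 g : R := Rintegral mu setT g.

Lemma continuous_integrable_itv g a b : continuous g ->
  mu.-integrable `[a, b] (EFin \o g).
Proof.
move=> cg; apply: continuous_compact_integrable; first exact: segment_compact.
exact: continuous_subspaceT.
Qed.

Lemma Cc_ball_patch K g a b : a <= - K -> K <= b -> Cc_ball K g ->
  g \_ `[a, b] = g.
Proof.
move=> aK Kb [_ g0]; apply/funext => t; rewrite patchE.
case: ifPn => // /negP tab; rewrite g0// ltNge; apply/negP => tK.
apply: tab; rewrite inE/= in_itv/=.
by move: tK; rewrite ler_norml => /andP[? ?]; apply/andP; split; lra.
Qed.

Lemma int1_itv K g a b : a <= - K -> K <= b -> Cc_ball K g ->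
  int1 g = \int[mu]_(t in `[a, b]) g t.
Proof. by move=> aK Kb cg; rewrite Rintegral_mkcond (Cc_ball_patch aK Kb cg). Qed.

Lemma Cc_ball_integrable K g : Cc_ball K g -> mu.-integrable setT (EFin \o g).
Proof.
move=> cg; have := continuous_integrable_itv (- K) K cg.1.
by rewrite integrable_mkcond// restrict_EFin (Cc_ball_patch (lexx _) (lexx _) cg).
Qed.

Lemma int1Z K c f : Cc_ball K f -> int1 (fun t => c * f t) = c * int1 f.
Proof. by move=> /Cc_ball_integrable cf; rewrite /int1 RintegralZl. Qed.

Lemma int1D K f g : Cc_ball K f -> Cc_ball K g ->
  int1 (fun t => f t + g t) = int1 f + int1 g.
Proof.
by move=> /Cc_ball_integrable cf /Cc_ball_integrable cg; rewrite /int1 RintegralD.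
Qed.

Lemma int1B K f g : Cc_ball K f -> Cc_ball K g ->
  int1 (fun t => f t - g t) = int1 f - int1 g.
Proof.
by move=> /Cc_ball_integrable cf /Cc_ball_integrable cg; rewrite /int1 RintegralB.
Qed.

Lemma int1_le K f g : Cc_ball K f -> Cc_ball K g -> (forall t, f t <= g t) ->
  int1 f <= int1 g.
Proof.
move=> /Cc_ball_integrable cf /Cc_ball_integrable cg fg.
by apply: le_Rintegral.
Qed.

Lemma Rintegral_itv_cst a b c : a <= b ->
  \int[mu]_(t in `[a, b]) (cst c t) = (b - a) * c.
Proof.
move=> ab; rewrite Rintegral_cst//= lebesgue_measure_itv/= lte_fin.
case: ltgtP ab => // [_ _|-> _]; first by rewrite -EFinD/= mulrC.
by rewrite subrr mulr0 mul0r.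
Qed.

Lemma Rintegral_itv_near_cst g a b c e : a <= b -> continuous g ->
  (forall t, a <= t <= b -> `|g t - c| <= e) ->
  `|\int[mu]_(t in `[a, b]) g t - (b - a) * c| <= (b - a) * e.
Proof.
move=> ab cg ge; rewrite -!Rintegral_itv_cst//.
have icst (d : R) : mu.-integrable `[a, b] (EFin \o cst d).
  by apply: continuous_integrable_itv => x; exact: cvg_cst.
have iB : mu.-integrable `[a, b] (EFin \o (fun t => g t - cst c t)).
  by apply: continuous_integrable_itv => x; apply: cvgB; [exact: cg|exact: cvg_cst].
rewrite -RintegralB//; last exact: continuous_integrable_itv.
apply: le_trans (le_normr_Rintegral _ iB) _ => //.
by apply: le_Rintegral => //=; exact: (integrable_abse iB).
Qed.

Lemma int1_norm_le K g e : 0 <= K -> Cc_ball K g -> (forall t, `|g t| <= e) ->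
  `|int1 g| <= 2 * K * e.
Proof.
move=> K0 cg ge; rewrite (int1_itv (lexx _) (lexx _) cg).
have := @Rintegral_itv_near_cst g (- K) K 0 e _ cg.1.
rewrite mulr0 subr0 opprK -mulr2n mulr_natl; apply; first by lra.
by move=> t _; rewrite subr0.
Qed.

Lemma Rintegral_itv_cat g a b c : a <= b -> b <= c -> continuous g ->
  \int[mu]_(t in `[a, c]) g t =
  \int[mu]_(t in `[a, b]) g t + \int[mu]_(t in `[b, c]) g t.
Proof.
move=> ab bc cg.
have := @Rintegral_itvB R g (BLeft a) (BRight c) b (continuous_integrable_itv a c cg).
rewrite !bnd_simp => /(_ ab bc) /eqP; rewrite subr_eq addrC => /eqP ->.
congr (_ + _); apply: Rintegral_itv_obnd_cbnd.
apply: integrableS (continuous_integrable_itv b c cg) => //.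
exact: subset_itv_oc_cc.
Qed.

Lemma Rintegral_itv_riemann g a h e (N : nat) : 0 <= h -> continuous g ->
  (forall t u, `|t - u| <= h -> `|g t - g u| <= e) ->
  `|\int[mu]_(t in `[a, a + h *+ N]) g t - \sum_(q < N) h * g (a + h *+ q)|
    <= h *+ N * e.
Proof.
move=> h0 cg ge; elim: N => [|N IH].
  by rewrite mulr0n addr0 set_itv1 Rintegral_set1 big_ord0 subr0 normr0 mul0r.
have stepE : a + h *+ N.+1 - (a + h *+ N) = h by rewrite mulrSr; lra.
have leN : a + h *+ N <= a + h *+ N.+1 by rewrite -subr_ge0 stepE.
rewrite big_ord_recr/= (@Rintegral_itv_cat g a (a + h *+ N)) ?lerDl ?mulrn_wge0//.
rewrite opprD addrACA; apply: le_trans (ler_normD _ _) _.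
rewrite [leRHS](_ : _ = h *+ N * e + h * e); last by rewrite mulrSr mulrDl.
apply: lerD => //; rewrite -[in X in `|_ - X * _|]stepE -[in leRHS]stepE.
apply: Rintegral_itv_near_cst => // t tN; apply: ge.
by rewrite ler_norml; apply/andP; split; lra.
Qed.

Lemma int1_riemann K g h e (Q : nat) : 0 <= h -> h *+ Q = K -> Cc_ball K g ->
  (forall t u, `|t - u| <= h -> `|g t - g u| <= e) ->
  `|int1 g - \sum_(q < Q.*2) h * g (h *+ q - K)| <= 2 * K * e.
Proof.
move=> h0 hQ cg ge.
have hQ2 : h *+ Q.*2 = 2 * K by rewrite -addnn mulrnDr hQ; lra.
rewrite (@int1_itv K g (- K) (- K + h *+ Q.*2))//; last by rewrite hQ2; lra.
have := Rintegral_itv_riemann (- K) Q.*2 h0 cg.1 ge.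
by under eq_bigr do rewrite addrC; rewrite hQ2.
Qed.

Lemma is_derive1_affine a b (x : R) : is_derive x 1 (fun t : R => a * t + b) a.
Proof. by apply: is_derive_eq; rewrite ?scaler0 ?addr0 /GRing.scale/= ?mulr1. Qed.

Lemma Cc_ball1_affine K g a b : a != 0 -> Cc_ball K g ->
  Cc_ball ((K + `|b|) / `|a|) (fun t => g (a * t + b)).
Proof. exact: (@Cc_ball_affine R R K g a b). Qed.

Lemma int1_affine_pos K g a b : 0 < a -> Cc_ball K g ->
  int1 (fun t => g (a * t + b)) = a^-1 * int1 g.
Proof.
move=> a0 cg; pose F t : R := a * t + b; pose L := (`|K| + `|b|) / a.
have aL : a * L = `|K| + `|b| by rewrite mulrC divfK ?gt_eqF.
have L0 : 0 <= L by rewrite divr_ge0 ?addr_ge0 ?(ltW a0).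
have Kb := ler_norm K; have bb := ler_norm b.
have Nb := ler_norm (- b); rewrite normrN in Nb.
have dF : derive1 F = cst a.
  apply/funext => t; rewrite derive1E.
  exact: (@derive_val _ _ _ _ _ _ _ (is_derive1_affine a b t)).
have cF : continuous F := @continuous_affine R R id a b (fun=> cvg_id).
have cgF := Cc_ball1_affine b (lt0r_neq0 a0) cg.
apply: (mulfI (lt0r_neq0 a0)); rewrite mulrA divff ?gt_eqF// mul1r -(int1Z a cgF).
rewrite (@int1_itv K g (F (- L)) (F L))//; last 2 first.
- by rewrite /F mulrN aL; lra.
- by rewrite /F aL; lra.
rewrite (@int1_itv L _ (- L) L)//; last first.
  apply: Cc_ballZ; apply: Cc_ballW cgF.
  by rewrite (gtr0_norm a0) ler_pM2r ?invr_gt0// lerD2r.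
rewrite /Rintegral (@integration_by_substitution_increasing R F g (- L) L).
- by congr fine; apply: eq_integral => t _; rewrite dF !fctE/= mulrC.
- lra.
- by move=> x y _ _ xy; rewrite /F ltrD2r ltr_pM2l.
- by rewrite dF => ? _; exact: cvg_cst.
- by rewrite dF; exact: is_cvg_cst.
- by rewrite dF; exact: is_cvg_cst.
- split.
  + by move=> x _; apply: ex_derive; exact: is_derive1_affine.
  + by apply: cvg_at_right_filter; exact: cF.
  + by apply: cvg_at_left_filter; exact: cF.
- exact: continuous_subspaceT cg.1.
Qed.

Lemma int1_opp K g : Cc_ball K g -> int1 (fun t => g (- t)) = int1 g.
Proof.
move=> cg; have Kb := ler_norm K.
have cgN : Cc_ball K (fun t => g (- t)).
  split => [t|t tK]; last by apply: cg.2; rewrite normrN.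
  by apply: continuous_comp; [exact: opp_continuous|exact: cg.1].
rewrite [RHS](@int1_itv K g (- `|K|) (- - `|K|)) ?lerN2 ?opprK//.
rewrite (@int1_itv K _ (- `|K|) `|K|) ?lerN2//.
rewrite /Rintegral -(opprK `|K|) (@integration_by_substitution_oppr R g (- `|K|)) ?opprK//.
  by have := normr_ge0 K; lra.
exact: continuous_subspaceT cg.1.
Qed.

Lemma int1_affine K g a b : a != 0 -> Cc_ball K g ->
  int1 (fun t => g (a * t + b)) = `|a|^-1 * int1 g.
Proof.
rewrite neq_lt => /orP[a0|a0] cg; last by rewrite gtr0_norm// (int1_affine_pos _ a0 cg).
have Na0 : 0 < - a by rewrite oppr_gt0.
rewrite ltr0_norm// -(int1_affine_pos b Na0 cg).
rewrite -[RHS](int1_opp (Cc_ball1_affine b (lt0r_neq0 Na0) cg)).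
by under [in RHS]eq_fun do rewrite mulrNN.
Qed.

End Integral1.

(** * Iterated integrals *)

Section Uncurrying.
Context {R : realType} {V W : normedModType R}.
Implicit Types (K : R) (G : V -> W -> R).

Lemma Cc_ball_swap K G : Cc_ball K (fun p : V * W => G p.1 p.2) ->
  Cc_ball K (fun p : W * V => G p.2 p.1).
Proof.
move=> [cG G0]; split => [p|[y x] Kp]; last first.
  by apply: (G0 (x, y)); move: Kp; rewrite !prod_normE/= maxC.
apply: (continuous_comp (f := fun p : W * V => (p.2, p.1))
  (g := fun p : V * W => G p.1 p.2)); last exact: cG.
by apply: cvg_pair; [exact: cvg_snd|exact: cvg_fst].
Qed.

Lemma Cc_ball_curry K G x : Cc_ball K (fun p : V * W => G p.1 p.2) -> Cc_ball K (G x).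
Proof.
move=> [cG G0]; split => [y|y Ky]; last first.
  by apply: (G0 (x, y)); rewrite prod_normE/= lt_max Ky orbT.
apply: (continuous_comp (f := fun y => (x, y)) (g := fun p : V * W => G p.1 p.2));
  last exact: cG.
by apply: cvg_pair; [exact: cvg_cst|exact: cvg_id].
Qed.

Lemma continuous_comp_fst (f : V -> R) : continuous f ->
  continuous (fun p : V * W => f p.1).
Proof. by move=> cf p; apply: (continuous_comp (f := fst)); [exact: cvg_fst|exact: cf]. Qed.

Lemma continuous_comp_snd (g : W -> R) : continuous g ->
  continuous (fun p : V * W => g p.2).
Proof. by move=> cg p; apply: (continuous_comp (f := snd)); [exact: cvg_snd|exact: cg]. Qed.

Lemma Cc_ball_prod K (f : V -> R) (g : W -> R) (H : V * W -> R) :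
  Cc_ball K f -> Cc_ball K g -> continuous H ->
  Cc_ball K (fun p : V * W => f p.1 * g p.2 * H p).
Proof.
move=> [cf f0] [cg g0] cH; split => [p|[x y]]; last first.
  rewrite prod_normE/= lt_max => /orP[/f0 ->|/g0 ->]; first by rewrite !mul0r.
  by rewrite mulr0 mul0r.
have cfg := continuousM (@continuous_comp_fst f cf p) (@continuous_comp_snd g cg p).
exact: (continuousM cfg (cH p)).
Qed.

Lemma continuous_lincomb (g : V -> R) (a b : R) (c : V) :
  continuous g -> continuous (fun p : V * V => g (a *: p.1 + b *: p.2 + c)).
Proof.
move=> cg p; apply: (continuous_comp (f := fun p : V * V => a *: p.1 + b *: p.2 + c)
  (g := g)); last exact: cg.
apply: cvgD; last exact: cvg_cst.
by apply: cvgD; apply: cvgZr; [exact: cvg_fst|exact: cvg_snd].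
Qed.

Lemma continuous_shear (g : V -> R) (d : R) :
  continuous g -> continuous (fun p : V * V => g (d *: p.2 + p.1)).
Proof.
move=> /(@continuous_lincomb g 1 d 0).
by under eq_fun do rewrite scale1r addr0 addrC.
Qed.

End Uncurrying.

Arguments continuous_comp_fst {R V W f}.
Arguments continuous_comp_snd {R V W g}.
Arguments continuous_lincomb {R V g} a b c.
Arguments continuous_shear {R V g} d.

Section SupNorm.
Context {R : realType} {n : nat}.
Implicit Types (x y : 'rV[R]_n) (e : R).

Lemma coord_norm_le x (i : 'I_n) : `|x ord0 i| <= `|x|.
Proof.
rewrite [leRHS]/Num.Def.normr /= mx_normrE; apply/bigmax_geP; right => /=.
by exists (ord0, i).
Qed.

Lemma rV_norm_le x e : 0 <= e -> (forall i, `|x ord0 i| <= e) -> `|x| <= e.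
Proof.
move=> e0 xe; rewrite [leLHS]/Num.Def.normr /= mx_normrE; apply/bigmax_leP; split => //.
by move=> [i j] _ /=; rewrite ord1.
Qed.

Lemma setc_dist x y k (t u e : R) : `|x - y| <= e -> `|t - u| <= e ->
  `|setc x k t - setc y k u| <= e.
Proof.
move=> xy tu; apply: rV_norm_le; first exact: le_trans xy.
move=> i; rewrite !mxE; case: ifP => // _.
by have := le_trans (coord_norm_le (x - y) i) xy; rewrite !mxE.
Qed.

End SupNorm.

Section IteratedIntegral.
Context {R : realType} {n : nat}.
Local Notation pt := 'rV[R]_n.
Implicit Types (K : R) (G H : pt -> R) (x y z : pt).

Lemma iterint0 k x : iterint k (fun=> 0) x = 0 :> R.
Proof.
elim: k x => // k IH x /=.
under [X in Rintegral _ _ X]funext => t do rewrite IH.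
by rewrite /Rintegral integral0_eq.
Qed.

Lemma iterint_eq0 K G k x (i : 'I_n) : (forall y, K < `|y| -> G y = 0) ->
  (k <= i)%N -> K < `|x ord0 i| -> iterint k G x = 0.
Proof.
move=> G0; elim: k x => [|k IH] x ki Kx /=.
  by apply: G0; apply: lt_le_trans Kx (coord_norm_le _ _).
under [X in Rintegral _ _ X]funext => t do rewrite IH ?(ltnW ki) ?mxE ?gtn_eqF//.
by rewrite /Rintegral integral0_eq.
Qed.

Lemma iterint_slice_of_modulus K G k x : Cc_ball K G -> (k < n)%N ->
  (forall d e, (forall y z, `|y - z| <= d -> `|G y - G z| <= e) ->
    forall y z, `|y - z| <= d -> `|iterint k G y - iterint k G z| <= (2 * K) ^+ k * e) ->
  0 <= K -> Cc_ball K (fun t => iterint k G (setc x k t)).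
Proof.
move=> cG kn mod K0; split => [|t Kt]; last first.
  by apply: (@iterint_eq0 K _ _ _ (Ordinal kn) cG.2) => //; rewrite mxE eqxx.
apply: dist_continuous => t e e0.
have C0 : 0 <= (2 * K) ^+ k by rewrite exprn_ge0 ?mulr_ge0.
have [d d0 dG] := Cc_ball_unif (@balls_compact_rV R n) cG (divr_gt0 e0 (ltr_wpDl C0 ltr01)).
exists d => // u tu; apply: le_trans (mod _ _ dG _ _ _) _.
  by apply: setc_dist => //; rewrite subrr normr0 ltW.
by rewrite mul_div_addr1_le// ltW.
Qed.

Lemma iterint_close K G H k d e : 0 <= K -> Cc_ball K G -> Cc_ball K H ->
  (k <= n)%N -> (forall y z, `|y - z| <= d -> `|G y - H z| <= e) ->
  forall y z, `|y - z| <= d -> `|iterint k G y - iterint k H z| <= (2 * K) ^+ k * e.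
Proof.
move=> K0; elim: k G H d e => [|k IH] G H d e cG cH kn GH y z yz.
  by rewrite expr0 mul1r; exact: GH.
have slice F x : Cc_ball K F -> Cc_ball K (fun t => iterint k F (setc x k t)).
  move=> cF; apply: iterint_slice_of_modulus => // d' e'.
  exact: IH (ltnW kn).
have [cGy cHz] := (slice G y cG, slice H z cH).
rewrite /= -!/(int1 _) -(int1B cGy cHz) exprS -mulrA.
apply: int1_norm_le (Cc_ballB cGy cHz) _ => // t.
apply: (IH _ _ d) (ltnW kn) GH _ _ _ => //; apply: setc_dist => //.
by rewrite subrr normr0 (le_trans _ yz).
Qed.

Lemma iterint_slice K G k x : 0 <= K -> Cc_ball K G -> (k < n)%N ->
  Cc_ball K (fun t => iterint k G (setc x k t)).
Proof.
move=> K0 cG kn; apply: iterint_slice_of_modulus => // d e.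
exact: iterint_close (ltnW kn).
Qed.

Lemma iterintD K G H k x : 0 <= K -> Cc_ball K G -> Cc_ball K H -> (k <= n)%N ->
  iterint k (fun x => G x + H x) x = iterint k G x + iterint k H x.
Proof.
move=> K0 cG cH; elim: k x => // k IH x kn /=.
rewrite -!/(int1 _) -(@int1D _ K); [|exact: iterint_slice..].
by under eq_fun do rewrite IH ?(ltnW kn)//.
Qed.

Lemma iterintZ K (c : R) G k x : 0 <= K -> Cc_ball K G -> (k <= n)%N ->
  iterint k (fun x => c * G x) x = c * iterint k G x.
Proof.
move=> K0 cG; elim: k x => // k IH x kn /=.
rewrite -!/(int1 _) -(@int1Z _ K); last exact: iterint_slice.
by under eq_fun do rewrite IH ?(ltnW kn)//.
Qed.

Lemma iterint_le K G H k x : 0 <= K -> Cc_ball K G -> Cc_ball K H -> (k <= n)%N ->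
  (forall x, G x <= H x) -> iterint k G x <= iterint k H x.
Proof.
move=> K0 cG cH + GH; elim: k x => // k IH x kn /=.
apply: (@int1_le _ K); [exact: iterint_slice..|].
by move=> t; apply: IH; exact: ltnW.
Qed.

Lemma iterint_affine K G (a : R) b k x : 0 <= K -> a != 0 ->
  Cc_ball K G -> (k <= n)%N ->
  iterint k (fun x => G (a *: x + b)) x = `|a| ^- k * iterint k G (a *: x + b).
Proof.
move=> K0 a0 cG; elim: k x => [|k IH] x kn /=; first by rewrite expr0 invr1 mul1r.
pose bk := b ord0 (Ordinal kn).
have setc_affine t : a *: setc x k t + b = setc (a *: x + b) k (a * t + bk).
  apply/rowP => i; rewrite !mxE; case: eqP => // ik.
  by congr (_ + b _ _); exact/val_inj.
under [X in Rintegral _ _ X]funext => t do rewrite IH ?(ltnW kn)// setc_affine.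
have cs := iterint_slice (a *: x + b) K0 cG kn.
rewrite -!/(int1 _) (int1Z _ (Cc_ball1_affine bk a0 cs)) (int1_affine _ a0 cs).
by rewrite mulrA exprS invfM [_^-1 * _]mulrC.
Qed.

Lemma iterint_indep G k x y :
  (forall i : 'I_n, (k <= i)%N -> x ord0 i = y ord0 i) ->
  iterint k G x = iterint k G y.
Proof.
elim: k x y => [|k IH] x y xy /=; first by congr G; apply/rowP => i; exact: xy.
apply: congr1; apply/funext => t; apply: IH => i ki; rewrite !mxE.
by case: eqP => // /eqP ik; apply: xy; rewrite ltn_neqAle eq_sym ik.
Qed.

Lemma intRnD K G H : 0 <= K -> Cc_ball K G -> Cc_ball K H ->
  intRn (fun x => G x + H x) = intRn G + intRn H.
Proof. by move=> K0 cG cH; exact: iterintD K0 cG cH _. Qed.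

Lemma intRnZ K (c : R) G : 0 <= K -> Cc_ball K G ->
  intRn (fun x => c * G x) = c * intRn G.
Proof. by move=> K0 cG; exact: iterintZ K0 cG _. Qed.

Lemma intRnN K G : 0 <= K -> Cc_ball K G -> intRn (fun x => - G x) = - intRn G.
Proof.
move=> K0 cG; rewrite -mulN1r -(intRnZ _ K0 cG).
by under [in RHS]eq_fun do rewrite mulN1r.
Qed.

Lemma intRnB K G H : 0 <= K -> Cc_ball K G -> Cc_ball K H ->
  intRn (fun x => G x - H x) = intRn G - intRn H.
Proof.
by move=> K0 cG cH; rewrite -(intRnN K0 cH) -(intRnD K0 cG (Cc_ballN cH)).
Qed.

Lemma intRn0 : intRn (fun _ : pt => 0 : R) = 0 :> R.
Proof. exact: iterint0. Qed.

Lemma intRn_sum (I : eqType) (r : seq I) (F : I -> pt -> R) K : 0 <= K ->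
  (forall i, i \in r -> Cc_ball K (F i)) ->
  intRn (fun x => \sum_(i <- r) F i x) = \sum_(i <- r) intRn (F i).
Proof.
move=> K0; elim: r => [_|i r IH cF].
  by under eq_fun do rewrite big_nil; rewrite intRn0 big_nil.
have cr j : j \in r -> Cc_ball K (F j) by move=> jr; apply: cF; rewrite in_cons jr orbT.
under eq_fun do rewrite big_cons.
by rewrite big_cons (intRnD K0 (cF i (mem_head _ _)) (Cc_ball_sum cr)) IH.
Qed.

Lemma intRn_le K G H : 0 <= K -> Cc_ball K G -> Cc_ball K H ->
  (forall x, G x <= H x) -> intRn G <= intRn H.
Proof. by move=> K0 cG cH GH; exact: iterint_le K0 cG cH _ GH. Qed.

Lemma le_norm_intRn K G : 0 <= K -> Cc_ball K G ->
  `|intRn G| <= intRn (fun x => `|G x|).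
Proof.
move=> K0 cG; have cN := Cc_ball_norm cG.
rewrite ler_norml -(intRnN K0 cN); apply/andP; split.
  by apply: (intRn_le K0 (Cc_ballN cN) cG) => x; rewrite lerNl -normrN ler_norm.
by apply: (intRn_le K0 cG cN) => x; exact: ler_norm.
Qed.

Lemma intRn_norm_le K G e : 0 <= K -> Cc_ball K G -> (forall x, `|G x| <= e) ->
  `|intRn G| <= (2 * K) ^+ n * e.
Proof.
move=> K0 cG Ge.
have := @iterint_close K G (fun=> 0) n 0 e K0 cG (Cc_ball0 K) (leqnn n) _ 0 0.
rewrite -!/(intRn _) intRn0 !subr0 normr0; apply => // y z _.
by rewrite subr0.
Qed.

Lemma intRn_affine K G (a : R) b : 0 <= K -> a != 0 -> Cc_ball K G ->
  intRn (fun x => G (a *: x + b)) = `|a| ^- n * intRn G.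
Proof.
move=> K0 a0 cG; rewrite /intRn (iterint_affine _ _ K0 a0 cG)//; congr (_ * _).
by apply: iterint_indep => i; rewrite leqNgt ltn_ord.
Qed.

Lemma intRn_translate K G b : 0 <= K -> Cc_ball K G ->
  intRn (fun x => G (x + b)) = intRn G.
Proof.
move=> K0 cG; have := intRn_affine b K0 (oner_neq0 R) cG.
by rewrite normr1 expr1n invr1 mul1r => <-; under [in RHS]eq_fun do rewrite scale1r.
Qed.

End IteratedIntegral.

Section Fubini.
Context {R : realType} {n : nat}.
Local Notation pt := 'rV[R]_n.
Implicit Types (K : R) (x y : pt).

Lemma iterint_param_unif (W : normedModType R) K (G : W -> pt -> R) k e :
  balls_compact (V := W) -> 0 <= K -> Cc_ball K (fun p : W * pt => G p.1 p.2) ->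
  (k <= n)%N -> 0 < e ->
  exists2 d, 0 < d & forall v w x y, `|v - w| <= d -> `|x - y| <= d ->
    `|iterint k (G v) x - iterint k (G w) y| <= e.
Proof.
move=> cW K0 cG kn e0.
have C0 : 0 <= (2 * K) ^+ k by rewrite exprn_ge0 ?mulr_ge0.
have cWpt := balls_compact_prod cW (@balls_compact_rV R n).
have [d d0 dG] := Cc_ball_unif cWpt cG (divr_gt0 e0 (ltr_wpDl C0 ltr01)).
exists d => // v w x y vw xy.
apply: le_trans (mul_div_addr1_le C0 (ltW e0)).
apply: (iterint_close (d := d) K0 (Cc_ball_curry v cG) (Cc_ball_curry w cG) kn) xy.
by move=> y' z' yz; have := dG (v, y') (w, z'); rewrite prod_normE/= ge_max vw yz; exact.
Qed.

Lemma Cc_ball_intRn (W : normedModType R) K (G : W -> pt -> R) :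
  balls_compact (V := W) -> 0 <= K -> Cc_ball K (fun p : W * pt => G p.1 p.2) ->
  Cc_ball K (fun w => intRn (G w)).
Proof.
move=> cW K0 cG; split => [|w Kw]; last first.
  rewrite -(@intRn0 R n); congr intRn; apply/funext => x.
  by apply: (cG.2 (w, x)); rewrite prod_normE/= lt_max Kw.
apply: dist_continuous => w e e0.
have [d d0 dG] := iterint_param_unif cW K0 cG (leqnn n) e0.
exists d => // v wv; apply: dG => //.
by rewrite subrr normr0 ltW.
Qed.

Lemma int1_param_continuous K (G : R -> pt -> R) : 0 <= K ->
  Cc_ball K (fun p : R * pt => G p.1 p.2) -> Cc_ball K (fun x => int1 (G^~ x)).
Proof.
move=> K0 cG; have cGs := Cc_ball_swap cG.
split => [|x Kx]; last first.
  rewrite /int1 /Rintegral integral0_eq// => t _; congr EFin.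
  by apply: (cG.2 (t, x)); rewrite prod_normE/= lt_max Kx orbT.
apply: dist_continuous => x e e0; have K2 : 0 <= 2 * K by rewrite mulr_ge0.
have cR := balls_compact_prod (@balls_compact_R R) (@balls_compact_rV R n).
have [d d0 dG] := Cc_ball_unif cR cG (divr_gt0 e0 (ltr_wpDl K2 ltr01)).
exists d => // y xy; have cx z := Cc_ball_curry (G := fun x t => G t x) z cGs.
rewrite -(int1B (cx x) (cx y)).
apply: le_trans (mul_div_addr1_le K2 (ltW e0)).
apply: int1_norm_le K0 (Cc_ballB (cx x) (cx y)) _ => t.
by have := dG (t, x) (t, y); rewrite prod_normE/= subrr normr0 ge_max xy ltW//; exact.
Qed.

(* Both sides are approximated by the same Riemann sum in the real variable. *)
Lemma int1_intRn_swap K (G : R -> pt -> R) : 0 <= K ->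
  Cc_ball K (fun p : R * pt => G p.1 p.2) ->
  int1 (fun t => intRn (G t)) = intRn (fun x => int1 (G^~ x)).
Proof.
move=> K0 cG; apply/eqP; rewrite -subr_eq0 -normr_le0.
apply/ler_addgt0Pl => e e0; rewrite addr0.
pose C := 4 * K * (2 * K) ^+ n; have C0 : 0 <= C by rewrite !mulr_ge0// exprn_ge0// mulr_ge0.
pose e' := e / (C + 1); have e'0 : 0 < e' by rewrite divr_gt0// ltr_wpDl.
have cR := balls_compact_prod (@balls_compact_R R) (@balls_compact_rV R n).
have [d d0 dG] := Cc_ball_unif cR cG e'0.
pose Q := (Num.truncn (K / d)).+1; pose h := K / Q%:R.
have hQ : h *+ Q = K by rewrite -mulr_natr divfK// pnatr_eq0.
have h0 : 0 <= h by rewrite divr_ge0.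
have hd : h <= d by rewrite ler_pdivrMr ?ltr0n// mulrC -ler_pdivrMr// ltW// truncnS_gt.
have Gclose x t u : `|t - u| <= h -> `|G t x - G u x| <= e'.
  move=> tu; have := dG (t, x) (u, x); apply.
  by rewrite prod_normE/= subrr normr0 ge_max (le_trans tu hd) ltW.
have cGt t := Cc_ball_curry t cG.
have cGx x := Cc_ball_curry (G := fun x t => G t x) x (Cc_ball_swap cG).
have close t u : `|t - u| <= h -> `|intRn (G t) - intRn (G u)| <= (2 * K) ^+ n * e'.
  move=> tu; rewrite -(intRnB K0 (cGt t) (cGt u)).
  by apply: intRn_norm_le (Cc_ballB (cGt t) (cGt u)) _ => // x; exact: Gclose.
pose S x := \sum_(q < Q.*2) h * G (h *+ q - K) x.
have cS : Cc_ball K S by apply: Cc_ball_sum => q _; exact: Cc_ballZ.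
have SE : \sum_(q < Q.*2) h * intRn (G (h *+ q - K)) = intRn S.
  rewrite (intRn_sum K0) => [|q _]; last exact: Cc_ballZ.
  by apply: eq_bigr => q _; rewrite (intRnZ _ K0 (cGt _)).
have cI := int1_param_continuous K0 cG.
have lhs := int1_riemann h0 hQ (Cc_ball_intRn (@balls_compact_R R) K0 cG) close.
have rhs : `|intRn (fun x => int1 (G^~ x)) - intRn S| <= (2 * K) ^+ n * (2 * K * e').
  rewrite -(intRnB K0 cI cS); apply: intRn_norm_le (Cc_ballB cI cS) _ => // x.
  by apply: int1_riemann h0 hQ (cGx x) _ => t u; exact: Gclose.
rewrite SE in lhs; rewrite -(subrKA (intRn S)) -[intRn S - _]opprB.
apply: le_trans (ler_normB _ _) _; apply: le_trans (lerD lhs rhs) _.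
rewrite [leLHS](_ : _ = C * e'); last by rewrite /C; ring.
exact: mul_div_addr1_le C0 (ltW e0).
Qed.

Lemma intRn_swap K (G : pt -> pt -> R) : 0 <= K ->
  Cc_ball K (fun p : pt * pt => G p.1 p.2) ->
  intRn (fun y => intRn (fun x => G x y)) = intRn (fun x => intRn (G x)).
Proof.
move=> K0 cG; have cpt := @balls_compact_rV R n.
suff swap k y : (k <= n)%N ->
    iterint k (fun y => intRn (fun x => G x y)) y = intRn (fun x => iterint k (G x) y).
  exact: swap.
elim: k y => [//|k IH] y kn /=.
under [X in Rintegral _ _ X]funext => t do rewrite IH ?(ltnW kn)//.
rewrite -/(int1 _) (@int1_intRn_swap K (fun t x => iterint k (G x) (setc y k t)))//.
split => [|[t x]].
  apply: dist_continuous => -[t x] e e0.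
  have [d d0 dG] := iterint_param_unif cpt K0 cG (ltnW kn) e0.
  exists d => // -[u z]; rewrite prod_normE/= ge_max => /andP[tu xz].
  by apply: dG => //; apply: setc_dist => //; rewrite subrr normr0 ltW.
rewrite prod_normE/= lt_max => /orP[Kt|Kx].
  apply: (@iterint_eq0 _ _ K _ _ _ (Ordinal kn)) => // [z Kz|]; last by rewrite mxE eqxx.
  exact: (Cc_ball_curry x cG).2.
have -> : G x = fun=> 0.
  by apply/funext => z; apply: (cG.2 (x, z)); rewrite prod_normE/= lt_max Kx.
exact: iterint0.
Qed.

End Fubini.

(** * Finite differences *)

Section Differences.
Context {R : realType} {n : nat}.
Local Notation pt := 'rV[R]_n.
Implicit Types (K B : R) (f g F G : pt -> R) (x y z h v : pt) (r k : nat).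

Lemma sdiffnS r h g x : sdiffn r.+1 h g x =
  sdiffn r h g (x + 2^-1 *: h) - sdiffn r h g (x - 2^-1 *: h).
Proof. by []. Qed.

Lemma sdiffnSr r h g : sdiffn r.+1 h g = sdiffn r h (sdiff h g).
Proof. exact: iterSr. Qed.

Lemma sdiffnD r k h g : sdiffn (r + k) h g = sdiffn r h (sdiffn k h g).
Proof. exact: iterD. Qed.

Lemma sdiffn0 r g x : sdiffn r.+1 0 g x = 0.
Proof. by rewrite sdiffnS scaler0 addr0 subr0 subrr. Qed.

Lemma sdiffnZ r h g (c : R) x : sdiffn r h (fun x => c * g x) x = c * sdiffn r h g x.
Proof. by elim: r x => // r IH x; rewrite !sdiffnS !IH mulrBr. Qed.

Lemma sdiffn_affine r h g (a : R) b x :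
  sdiffn r h (fun x => g (a *: x + b)) x = sdiffn r (a *: h) g (a *: x + b).
Proof.
elim: r x => // r IH x; rewrite !sdiffnS !IH.
by congr (_ - _); congr sdiffn;
  rewrite ?scalerDr ?scalerN !scalerA [2^-1 * a]mulrC addrAC.
Qed.

Lemma sdiff_continuous h g : continuous g -> continuous (sdiff h g).
Proof.
move=> cg x; have cgt b := continuous_translate b cg x.
exact: (continuousB (cgt (2^-1 *: h)) (cgt (- (2^-1 *: h)))).
Qed.

Lemma sdiffn_continuous r h g : continuous g -> continuous (sdiffn r h g).
Proof. by move=> cg; elim: r => // r IH; exact: sdiff_continuous. Qed.

Lemma sdiffn_norm_le r h g B : (forall x, `|g x| <= B) ->
  forall x, `|sdiffn r h g x| <= 2 ^+ r * B.
Proof.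
move=> gB; elim: r => [|r IH] x; first by rewrite expr0 mul1r.
rewrite sdiffnS exprS -mulrA mulr_natl mulr2n.
by apply: le_trans (ler_normB _ _) _; exact: lerD.
Qed.

Definition stencil r h x (p : nat) : pt := x + (p%:R - r%:R / 2) *: h.

Lemma stencil_dist r h x (p : 'I_r.+1) : `|stencil r h x p - x| <= r%:R * `|h|.
Proof.
rewrite /stencil addrAC subrr add0r normrZ ler_wpM2r//.
have : (p : nat)%:R <= r%:R :> R by rewrite ler_nat -ltnS.
have : 0 <= (p : nat)%:R :> R by [].
by rewrite ler_norml => ? ?; apply/andP; split; lra.
Qed.

Lemma sdiffn_neq0 r h g x : sdiffn r h g x != 0 ->
  exists p : 'I_r.+1, g (stencil r h x p) != 0.
Proof.
elim: r x => [|r IH] x.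
  by exists ord0; rewrite /stencil mul0r subr0 scale0r addr0.
have stencilS (a : R) (p q : nat) : a + (p%:R - r%:R / 2) = q%:R - r.+1%:R / 2 ->
    stencil r h (x + a *: h) p = stencil r.+1 h x q.
  by rewrite /stencil -addrA -scalerDl => ->.
rewrite sdiffnS => nz.
have [Dp0|/IH[p gp]] := eqVneq (sdiffn r h g (x + 2^-1 *: h)) 0; last first.
  exists (lift ord0 p); rewrite -(@stencilS 2^-1 p)//=.
  by rewrite /fintype.bump/= add1n -!natr1; field.
have /IH[p gp] : sdiffn r h g (x + (- 2^-1) *: h) != 0.
  by move: nz; rewrite Dp0 sub0r oppr_eq0 scaleNr.
by exists (widen_ord (leqnSn _) p); rewrite -(@stencilS (- 2^-1) p)//= -natr1; field.
Qed.

Lemma Cc_ball_sdiffn K r h g : Cc_ball K g -> Cc_ball (K + r%:R * `|h|) (sdiffn r h g).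
Proof.
move=> [cg g0]; split; first exact: sdiffn_continuous.
move=> x Kx; apply/eqP; apply: contraTT isT => /sdiffn_neq0[p].
rewrite g0 ?eqxx//; have := stencil_dist h x p.
by have := ler_normB (stencil r h x p) (stencil r h x p - x); rewrite subKr; lra.
Qed.

Lemma sum_sign_bin_diff k (u : nat -> R) :
  \sum_(m < k.+1) (-1) ^+ m * 'C(k, m)%:R * (u m - u m.+1) =
  \sum_(m < k.+2) (-1) ^+ m * 'C(k.+1, m)%:R * u m.
Proof.
under eq_bigr do rewrite mulrBr.
rewrite sumrB [X in X - _]big_ord_recl [RHS]big_ord_recl !bin0 expr0 !mul1r -addrA.
congr (_ + _); under [RHS]eq_bigr => m _ do
  rewrite lift0 binS natrD exprS mulN1r mulNr mulrDr mulNr mulrDl opprD.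
rewrite big_split sumrN [in RHS]sumrN; congr (_ - _).
under [LHS]eq_bigr => m _ do rewrite lift0 exprS mulN1r !mulNr.
by rewrite sumrN [in RHS]big_ord_recr/= bin_small// mulr0 mul0r addr0.
Qed.

Lemma sdiffn_forward k h g x :
  (-1) ^+ k * sdiffn k h g (x + (k%:R / 2) *: h) =
  \sum_(m < k.+1) (-1) ^+ m * 'C(k, m)%:R * g (x + m%:R *: h).
Proof.
elim: k g x => [|k IH] g x.
  by rewrite big_ord_recl big_ord0/= mul0r bin0 !mul1r addr0.
rewrite -(sum_sign_bin_diff k (fun m => g (x + m%:R *: h))) sdiffnSr exprS mulN1r mulNr.
have -> : x + (k.+1%:R / 2) *: h = (x + 2^-1 *: h) + (k%:R / 2) *: h.
  by rewrite -addrA -scalerDl -natr1; congr (_ + _ *: _); field.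
rewrite IH -sumrN; apply: eq_bigr => m _; rewrite -mulrN; congr (_ * _).
rewrite /sdiff opprB; congr (g _ - g _); first by rewrite [x + _ + _]addrAC addrK.
by rewrite -!addrA -!scalerDl; congr (_ + _ *: _); rewrite -natr1; field.
Qed.

Lemma intRn_sdiff K F G h : 0 <= K -> continuous F -> Cc_ball K G ->
  intRn (fun x => F x * sdiff h G x) = - intRn (fun x => G x * sdiff h F x).
Proof.
move=> K0 cF cG; pose u := 2^-1 *: h; pose K1 := K + `|u|.
have K10 : 0 <= K1 by rewrite addr_ge0.
have cG1 : Cc_ball K1 G by apply: Cc_ballW cG; rewrite lerDl.
have cGp : Cc_ball K1 (fun x => F x * G (x + u)).
  by apply: Cc_ballMl => //; exact: Cc_ball_translate.
have cGm : Cc_ball K1 (fun x => F x * G (x - u)).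
  by apply: Cc_ballMl => //; rewrite /K1 -normrN; exact: Cc_ball_translate.
have cF' v : Cc_ball K1 (fun x => G x * F (x + v)).
  by apply: Cc_ballMr => //; exact: continuous_translate.
under eq_fun do rewrite mulrBr; under [in RHS]eq_fun do rewrite mulrBr.
rewrite (intRnB K10 cGp cGm) (intRnB K10 (cF' u) (cF' (- u))) opprB.
rewrite -(intRn_translate (- u) K10 cGp) -(intRn_translate u K10 cGm).
by congr (_ - _); congr intRn; apply/funext => x; rewrite ?subrK ?addrK mulrC.
Qed.

Lemma intRn_sdiffn K F G h r : 0 <= K -> continuous F -> Cc_ball K G ->
  intRn (fun x => F x * sdiffn r h G x) =
  (-1) ^+ r * intRn (fun x => G x * sdiffn r h F x).
Proof.
move=> K0; elim: r F => [|r IH] F cF cG.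
  by rewrite expr0 mul1r; congr intRn; apply/funext => x; rewrite mulrC.
have K1 : 0 <= K + r%:R * `|h| by rewrite addr_ge0// mulr_ge0.
rewrite (intRn_sdiff _ K1 cF (Cc_ball_sdiffn r h cG)).
under eq_fun do rewrite mulrC.
by rewrite IH//; [rewrite -sdiffnSr exprS mulN1r mulNr|exact: sdiff_continuous].
Qed.

End Differences.

(** * Smoothness *)

Section Increments.
Context {R : realType} {V : normedModType R}.
Implicit Types (g : V -> R) (x v z b : V) (B c d : R).

Lemma increment_is_derive g x v c :
  (forall e, 0 < e -> exists2 d, 0 < d & forall t, `|t| <= d ->
    `|g (x + t *: v) - g x - t * c| <= e * `|t|) -> is_derive x v g c.
Proof.
move=> gc; suff lim_c : (t^-1 *: ((g \o shift x) (t *: v) - g x)) @[t --> 0^'] --> c.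
  by apply: DeriveDef; [apply: cvgP lim_c|exact: cvg_lim lim_c].
apply/cvgrPdist_le => e /gc[d d0 dg]; near=> t.
have t0 : t != 0 by near: t; exact: nbhs_dnbhs_neq.
have td : `|t| <= d by near: t; exact: dnbhs0_le.
rewrite /= [t *: v + x]addrC -(ler_pM2l (_ : 0 < `|t|)) ?normr_gt0//.
rewrite -normrM mulrBr /GRing.scale/= mulrA divff// mul1r distrC mulrC.
by rewrite [`|t| * e]mulrC [c * t]mulrC; exact: dg.
Unshelve. all: by end_near. Qed.

Lemma is_derive_translate g v b x c :
  is_derive (x + b) v g c -> is_derive x v (fun x => g (x + b)) c.
Proof.
have quotientE :
    (fun t : R => t^-1 *: (((fun x => g (x + b)) \o shift x) (t *: v) - g (x + b))) =
    (fun t : R => t^-1 *: ((g \o shift (x + b)) (t *: v) - g (x + b))).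
  by apply/funext => t /=; rewrite addrA.
by move=> [ex val]; split; [rewrite /derivable quotientE|rewrite /derive quotientE].
Qed.

Lemma is_derive_line g z v (t c : R) :
  is_derive (z + t *: v) v g c -> is_derive t 1 (fun t : R => g (z + t *: v)) c.
Proof.
have quotientE :
    (fun s : R => s^-1 *: (((fun t : R => g (z + t *: v)) \o shift t) (s *: 1)
      - g (z + t *: v))) =
    (fun s : R => s^-1 *: ((g \o shift (z + t *: v)) (s *: v) - g (z + t *: v))).
  apply/funext => s /=; rewrite addrCA -scalerDl.
  by congr (_ *: (g (_ + (_ + _) *: _) - _)); rewrite /GRing.scale/= mulr1.
by move=> [ex val]; split; [rewrite /derivable quotientE|rewrite /derive quotientE].
Qed.

Lemma increment_le (f f' : R -> R) (a b B : R) : (forall t : R, is_derive t 1 f (f' t)) ->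
  (forall t, `|t - a| <= `|b - a| -> `|f' t| <= B) -> `|f b - f a| <= B * `|b - a|.
Proof.
move=> ff' f'B.
have cf p q : {within `[p, q], continuous f}.
  apply: continuous_subspaceT => t; apply/differentiable_continuous/derivable1_diffP.
  by case: (ff' t).
have [ab|/ltW ba] := leP a b.
  have [t /itvP tab ->] := MVT_segment ab (fun t _ => ff' t) (cf a b).
  by rewrite normrM ler_wpM2r// f'B// !ger0_norm ?subr_ge0 ?lerD2r ?tab.
have [t /itvP tba E] := MVT_segment ba (fun t _ => ff' t) (cf b a).
rewrite distrC E normrM [in leRHS]distrC ler_wpM2r// f'B//.
by rewrite !ler0_norm ?subr_le0 ?lerN2 ?lerD2r ?tba.
Qed.

Lemma line_increment_le g (dg : V -> R) v B z (t : R) :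
  (forall x, is_derive x v g (dg x)) ->
  (forall u : R, `|u| <= `|t| -> `|dg (z + u *: v)| <= B) ->
  `|g (z + t *: v) - g z| <= B * `|t|.
Proof.
move=> gdg dB.
have := @increment_le (fun t => g (z + t *: v)) (fun t => dg (z + t *: v)) 0 t B.
rewrite scale0r addr0 subr0; apply => [u|u]; first exact: is_derive_line.
by rewrite subr0; exact: dB.
Qed.

End Increments.

Section Smoothness.
Context {R : realType} {n : nat}.
Local Notation pt := 'rV[R]_n.
Local Notation "'e_ i" := (delta_mx ord0 i : pt) (at level 8, i at level 2).
Implicit Types (K B : R) (f g F G : pt -> R) (x y z h v : pt) (r k : nat).

Lemma coord_increment_le F (dF : 'I_n -> pt -> R) B x y :
  (forall i z, is_derive z 'e_i F (dF i z)) ->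
  (forall i z, `|z - y| <= `|x - y| -> `|dF i z| <= B) ->
  `|F x - F y| <= n%:R * B * `|x - y|.
Proof.
move=> FdF dB; pose p k : pt := \row_(i < n) (if (i < k)%N then x ord0 i else y ord0 i).
have p0 : p 0%N = y by apply/rowP => i; rewrite mxE.
have pn : p n = x by apply/rowP => i; rewrite mxE ltn_ord.
have xy_coord i : `|x ord0 i - y ord0 i| <= `|x - y|.
  by have := coord_norm_le (x - y) i; rewrite !mxE.
suff path_le k : (k <= n)%N -> `|F (p k) - F y| <= k%:R * B * `|x - y|.
  by have := path_le n (leqnn n); rewrite pn.
elim: k => [_|k IH kn]; first by rewrite p0 subrr normr0 !mul0r.
pose i := Ordinal kn; pose t := x ord0 i - y ord0 i.
have B0 : 0 <= B by apply: le_trans (dB i y _); rewrite ?subrr ?normr0.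
have -> : p k.+1 = p k + t *: 'e_i.
  apply/rowP => j; rewrite !mxE eqxx/= ltnS leq_eqVlt.
  have [->|ji] := eqVneq j i; first by rewrite eqxx ltnn/= mulr1 addrC subrK.
  by rewrite mulr0 addr0 (_ : (j == k :> nat) = false)//; apply/negbTE.
rewrite -(subrKA (F (p k))) -[k.+1%:R]nat1r !mulrDl mul1r.
apply: le_trans (ler_normD _ _) _; apply: lerD; last exact: IH (ltnW kn).
apply: le_trans (line_increment_le (FdF i) _) _ => [u ut|].
  apply: dB; apply: rV_norm_le => // j; rewrite !mxE/=.
  have [->|ji] := eqVneq j i; last first.
    by rewrite mulr0 addr0; case: ifP => _; rewrite ?subrr ?normr0.
  by rewrite ltnn mulr1 addrAC subrr add0r; exact: le_trans ut (xy_coord i).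
by apply: ler_wpM2l => //; exact: xy_coord.
Qed.

Lemma is_derive_sum_coord (c : 'I_n -> R) i z :
  is_derive z 'e_i (fun z => \sum_j z ord0 j * c j) (c i).
Proof.
apply: increment_is_derive => e e0; exists 1 => // t _.
rewrite -sumrB (bigD1 i)//= big1 => [|j ji]; last first.
  by rewrite !mxE (negbTE ji) mulr0 addr0 subrr.
rewrite !mxE !eqxx/= [X in `|X|](_ : _ = 0); last by ring.
by rewrite normr0 mulr_ge0// ltW.
Qed.

Lemma derive_Cc_ball_eq0 K g v x : Cc_ball K g -> K < `|x| -> 'D_v g x = 0.
Proof.
move=> [_ g0] Kx; apply: cvg_lim => //; apply: cvg_near_cst.
have v1 : 0 < `|v| + 1 by rewrite ltr_wpDl.
have e0 : 0 < (`|x| - K) / (`|v| + 1) by rewrite divr_gt0// subr_gt0.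
near=> t; rewrite /= g0 ?(g0 x)// ?subrr ?scaler0//.
have : `|t| < (`|x| - K) / (`|v| + 1) by near: t; exact: dnbhs0_lt.
rewrite ltr_pdivlMr// mulrDr mulr1 => tv.
have := ler_normB (t *: v + x) (t *: v); rewrite addrAC subrr add0r normrZ.
by have := normr_ge0 t; lra.
Unshelve. all: by end_near. Qed.

Lemma CL_continuous k g : CL k g -> continuous g.
Proof. by case: k => [|k] []. Qed.

Lemma CL_is_derive k g i x : CL k.+1 g -> is_derive x 'e_i g ('D_('e_i) g x).
Proof. by move=> [_ /(_ i)[dg _]]; exact: derivableP. Qed.

Lemma CLW k g : CL k.+1 g -> CL k g.
Proof.
elim: k g => [|k IH] g; first by case.
by move=> [cg dg]; split => // i; have [dgi /IH] := dg i.
Qed.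

Lemma CL_le k r g : (k <= r)%N -> CL r g -> CL k g.
Proof. by move=> /subnK <-; elim: (r - k)%N => // m IH /CLW. Qed.

Lemma CLD k f g : CL k f -> CL k g -> CL k (fun x => f x + g x).
Proof.
have cD f' g' : continuous f' -> continuous g' -> continuous (fun x : pt => f' x + g' x).
  by move=> cf cg x; exact: (continuousD (cf x) (cg x)).
elim: k f g => [|k IH] f g Cf Cg; first by split => //; exact: cD Cf.1 Cg.1.
split => [|i]; first exact: cD Cf.1 Cg.1.
have [[df Cdf] [dg Cdg]] := (Cf.2 i, Cg.2 i).
split => [x|]; first exact: derivableD.
by under eq_fun do rewrite deriveD//; exact: IH.
Qed.

Lemma CLM k f g : CL k f -> CL k g -> CL k (fun x => f x * g x).
Proof.
have cM f' g' : continuous f' -> continuous g' -> continuous (fun x : pt => f' x * g' x).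
  by move=> cf cg x; exact: (continuousM (cf x) (cg x)).
elim: k f g => [|k IH] f g Cf Cg; first by split => //; exact: cM Cf.1 Cg.1.
split => [|i]; first exact: cM Cf.1 Cg.1.
have [[df Cdf] [dg Cdg]] := (Cf.2 i, Cg.2 i).
split => [x|]; first exact: derivableM.
by under eq_fun do rewrite deriveM//; apply: CLD; apply: IH => //; exact: CLW.
Qed.

Lemma CL_partial k K g i : CL k.+1 g -> Cc_ball K g -> Cc_ball K ('D_('e_i) g).
Proof.
move=> [_ /(_ i)[_ /CL_continuous cdg]] cg; split => // x.
exact: derive_Cc_ball_eq0 cg.
Qed.

Lemma is_derive_sdiffn g dg v h r : (forall x, is_derive x v g (dg x)) ->
  forall x, is_derive x v (sdiffn r h g) (sdiffn r h dg x).
Proof.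
move=> gdg; elim: r => // r IH x; rewrite sdiffnS.
exact: (is_deriveB (is_derive_translate (IH _)) (is_derive_translate (IH _))).
Qed.

Lemma sdiffn_smooth_le k K g : CL k g -> Cc_ball K g ->
  exists2 C, 0 <= C & forall h x, `|sdiffn k h g x| <= C * `|h| ^+ k.
Proof.
elim: k g => [|k IH] g Cg cg.
  have [B B0 gB] := Cc_ball_bounded (@balls_compact_rV R n) cg.
  by exists B => // h x; rewrite expr0 mulr1.
have /fin_all_exists2[C C0 dgC] i := IH _ (Cg.2 i).2 (CL_partial i Cg cg).
exists (n%:R * \sum_i C i) => [|h x]; first by rewrite mulr_ge0// sumr_ge0.
rewrite sdiffnS; apply: le_trans.
  apply: (coord_increment_le (dF := fun i => sdiffn k h ('D_('e_i) g))
    (B := (\sum_i C i) * `|h| ^+ k)) => [i z|i z _].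
    by apply: is_derive_sdiffn => w; exact: CL_is_derive Cg.
  by apply: le_trans (dgC i h z) _; rewrite ler_wpM2r ?exprn_ge0// le_sum_term.
have -> : x + 2^-1 *: h - (x - 2^-1 *: h) = h.
  by apply/rowP => i; rewrite !mxE; field.
by rewrite exprSr !mulrA.
Qed.

Lemma CL1_increment K g e : CL 1 g -> Cc_ball K g -> 0 < e ->
  exists2 d, 0 < d & forall y v, `|v| <= d ->
    `|g (y + v) - g y - \sum_i v ord0 i * 'D_('e_i) g y| <= e * `|v|.
Proof.
move=> Cg cg e0; have e1 : 0 < e / (n%:R + 1) by rewrite divr_gt0// ltr_wpDl.
have /fin_all_exists2[d d0 dg] i :=
  Cc_ball_unif (@balls_compact_rV R n) (CL_partial i Cg cg) e1.
pose d' := \big[Num.min/1]_i d i.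
have d'0 : 0 < d' by apply/bigmin_gtP; split => // i _; exact: d0.
exists d' => // y v vd.
pose F z := g z - \sum_i z ord0 i * 'D_('e_i) g y.
have -> : g (y + v) - g y - \sum_i v ord0 i * 'D_('e_i) g y = F (y + v) - F y.
  rewrite /F; under [X in _ = _ - X - _]eq_bigr do rewrite mxE mulrDl.
  by rewrite big_split/=; ring.
apply: le_trans (coord_increment_le (dF := fun i z => 'D_('e_i) g z - 'D_('e_i) g y)
  (B := e / (n%:R + 1)) _ _) _ => [i z|i z|].
- exact: (is_deriveB (CL_is_derive i z Cg) (is_derive_sum_coord _ i z)).
- rewrite [y + v]addrC addrK => zy; apply: dg; apply: le_trans zy _.
  by apply: le_trans vd _; exact: bigmin_le.
by rewrite [y + v]addrC addrK ler_wpM2r// mul_div_addr1_le// ltW.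
Qed.

End Smoothness.

(** * Vanishing moments *)

Section Moments.
Context {R : realType} {n : nat}.
Local Notation pt := 'rV[R]_n.
Implicit Types (rho K e : R) (th ps : pt -> R) (x z : pt) (p : nat).

Definition vanishing_moments p ps : Prop := forall a : 'I_n -> nat, (\sum_(i < n) a i < p)%N ->
  intRn (fun x => (\prod_(i < n) x ord0 i ^+ a i) * ps x) = 0.

Lemma vanishing_moments_int p ps : vanishing_moments p.+1 ps -> intRn ps = 0.
Proof.
move=> /(_ (fun=> 0%N)); rewrite sum_nat_const muln0 => /(_ isT) <-.
by congr intRn; apply/funext => x; rewrite big1 ?mul1r.
Qed.

Lemma vanishing_moments_coord p ps i : vanishing_moments p.+1 ps ->
  vanishing_moments p (fun x => x ord0 i * ps x).
Proof.
move=> vps a ap; rewrite -[RHS](vps (fun j => (a j + (j == i))%N)); last first.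
  by rewrite big_split/= -[(\sum_(j < n) (j == i))%N]big_mkcond/= big_pred1_eq addn1.
congr intRn; apply/funext => x; rewrite mulrA; congr (_ * _).
rewrite (bigD1 i)//= [RHS](bigD1 i)//= eqxx addn1 exprSr mulrAC; congr (_ * _).
by apply: eq_bigr => j /negbTE ->; rewrite addn0.
Qed.

Lemma Cc_ball_coordM K ps i : Cc_ball K ps -> Cc_ball K (fun x => x ord0 i * ps x).
Proof. by apply: Cc_ballMl => x; exact: coord_continuous. Qed.

Lemma is_derive_dilated_pairing rho K th ps z (eta : R) :
  0 <= K -> CL 1 th -> Cc_ball rho th -> Cc_ball K ps ->
  is_derive eta 1 (fun eta : R => intRn (fun x => th (eta *: x + z) * ps x))
    (\sum_i intRn (fun x =>
      'D_(delta_mx ord0 i) th (eta *: x + z) * (x ord0 i * ps x))).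
Proof.
move=> K0 Cth cth cps; have [B B0 psB] := Cc_ball_bounded (@balls_compact_rV R n) cps.
have cdil (F : pt -> R) (e : R) : continuous F -> Cc_ball K (fun x => F (e *: x + z) * ps x).
  by move=> cF; apply: Cc_ballMl => //; exact: continuous_affine.
have cD i : Cc_ball K (fun x => 'D_(delta_mx ord0 i) th (eta *: x + z) * (x ord0 i * ps x)).
  apply: Cc_ballMl (Cc_ball_coordM i cps).
  exact: continuous_affine (CL_partial i Cth cth).1.
have cS : Cc_ball K (fun x => \sum_i
    'D_(delta_mx ord0 i) th (eta *: x + z) * (x ord0 i * ps x)).
  exact: Cc_ball_sum.
apply: increment_is_derive => e e0; pose C := (2 * K) ^+ n * (K * B).
have C0 : 0 <= C by rewrite mulr_ge0 ?exprn_ge0 ?mulr_ge0.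
have [d d0 dth] := CL1_increment Cth cth (divr_gt0 e0 (ltr_wpDl C0 ltr01)).
exists (d / (K + 1)) => [|t]; first by rewrite divr_gt0// ltr_wpDl.
rewrite ler_pdivlMr ?ltr_wpDl// => td.
rewrite (_ : t *: 1 = t :> R); last exact: mulr1.
rewrite -(intRn_sum K0 (fun i _ => cD i)) -(intRnZ t K0 cS).
rewrite -(intRnB K0 (cdil _ _ cth.1) (cdil _ _ cth.1)).
have cdiff := Cc_ballB (cdil _ (eta + t) cth.1) (cdil _ eta cth.1).
rewrite -(intRnB K0 cdiff (Cc_ballZ t cS)).
apply: le_trans (intRn_norm_le (e := e / (C + 1) * (K * `|t|) * B) K0
  (Cc_ballB cdiff (Cc_ballZ t cS)) _) _ => [x|]; last first.
  rewrite [leLHS](_ : _ = C * (e / (C + 1)) * `|t|); last by rewrite /C; ring.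
  by rewrite ler_wpM2r// mul_div_addr1_le// ltW.
have [xK|/cps.2 ->] := leP `|x| K; last first.
  rewrite !mulr0 subr0 big1 ?mulr0 ?subr0 ?normr0 => [|i _]; last by rewrite !mulr0.
  by rewrite !mulr_ge0 ?invr_ge0 ?addr_ge0// ltW.
have txK : `|t *: x| <= K * `|t| by rewrite normrZ mulrC ler_wpM2r.
rewrite [X in `|X|](_ : _ = (th (eta *: x + z + t *: x) - th (eta *: x + z) -
    \sum_i (t *: x) ord0 i * 'D_(delta_mx ord0 i) th (eta *: x + z)) * ps x).
  rewrite normrM; apply: ler_pM => //; apply: le_trans (dth _ _ _) _.
    by apply: le_trans txK (le_trans _ td); rewrite mulrC ler_wpM2l// lerDl.
  by rewrite ler_wpM2l// divr_ge0 ?addr_ge0// ltW.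
rewrite scalerDl [_ + t *: x + z]addrAC !mulrBl mulr_suml mulr_sumr; congr (_ - _).
by apply: eq_bigr => i _; rewrite mxE; ring.
Qed.

(* Differentiating in [eta] trades one derivative of [th] for one moment of [ps]. *)
Lemma dilated_pairing_le p rho K th ps : 0 <= K -> CL p th -> Cc_ball rho th ->
  Cc_ball K ps -> vanishing_moments p ps ->
  exists2 C, 0 <= C & forall (eta : R) z,
    `|intRn (fun x => th (eta *: x + z) * ps x)| <= C * `|eta| ^+ p.
Proof.
move=> K0; elim: p th ps => [|p IH] th ps Cth cth cps vps.
  have [A A0 thA] := Cc_ball_bounded (@balls_compact_rV R n) cth.
  have [B B0 psB] := Cc_ball_bounded (@balls_compact_rV R n) cps.
  exists ((2 * K) ^+ n * (A * B)) => [|eta z].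
    by rewrite !mulr_ge0 ?exprn_ge0 ?mulr_ge0.
  rewrite expr0 mulr1; apply: intRn_norm_le K0 _ _ => [|x].
    by apply: Cc_ballMl cps; apply: continuous_affine; exact: cth.1.
  by rewrite normrM; exact: ler_pM.
have /fin_all_exists2[C C0 dC] i := IH _ _ (Cth.2 i).2 (CL_partial i Cth cth)
  (Cc_ball_coordM i cps) (vanishing_moments_coord i vps).
exists (\sum_i C i) => [|eta z]; first by rewrite sumr_ge0.
pose I (eta : R) := intRn (fun x => th (eta *: x + z) * ps x).
have I0 : I 0 = 0.
  rewrite /I; under eq_fun do rewrite scale0r add0r.
  by rewrite (intRnZ _ K0 cps) (vanishing_moments_int vps) mulr0.
have Ipos : CL 1 th by apply: CL_le Cth.
have := increment_le (B := (\sum_i C i) * `|eta| ^+ p) (a := 0) (b := eta)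
  (fun t => is_derive_dilated_pairing z t K0 Ipos cth cps).
rewrite -/(I _) -/(I 0) I0 !subr0 -mulrA -exprSr; apply => t; rewrite subr0 => teta.
apply: le_trans (ler_norm_sum _ _ _) _; rewrite mulr_suml.
apply: ler_sum => i _; apply: le_trans (dC i t z) _.
by rewrite ler_wpM2l ?lerXn2r ?nnegrE.
Qed.

End Moments.

(** * Averaging operators *)

Section Averages.
Context {R : realType} {n : nat}.
Local Notation pt := 'rV[R]_n.
Definition averaging_kernel (rho : R) (th : pt -> R) : Prop :=
  [/\ 0 <= rho, Cc_ball rho th, forall u, 0 <= th u & intRn th = 1].

Variables (rho : R) (th : pt -> R).
Hypothesis kerth : averaging_kernel rho th.
Let rho0 : 0 <= rho. Proof. by case: kerth. Qed.
Let cth : Cc_ball rho th. Proof. by case: kerth. Qed.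
Let th0 u : 0 <= th u. Proof. by case: kerth. Qed.
Let th1 : intRn th = 1. Proof. by case: kerth. Qed.
Implicit Types (d e B : R) (x u z : pt) (g : pt -> R) (k : nat).

Lemma mean_norm_le (G : pt -> R) B : continuous G ->
  (forall u, `|u| <= rho -> `|G u| <= B) -> `|intRn (fun u => th u * G u)| <= B.
Proof.
move=> cG GB; have cthG := Cc_ballMr cth cG.
apply: le_trans (le_norm_intRn rho0 cthG) _.
rewrite -[B]mulr1 -th1 -(intRnZ B rho0 cth).
apply: intRn_le rho0 (Cc_ball_norm cthG) (Cc_ballZ B cth) _ => u.
have [uK|/cth.2 ->] := leP `|u| rho; last by rewrite mul0r normr0 mulr0.
by rewrite normrM ger0_norm// mulrC ler_wpM2r ?GB.
Qed.

Definition avg d g x := intRn (fun u => th u * g (d *: u + x)).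

Lemma Cc_ball_avg_integrand d g x : continuous g ->
  Cc_ball rho (fun u => th u * g (d *: u + x)).
Proof. by move=> cg; apply: Cc_ballMr => //; exact: continuous_affine. Qed.

Lemma avgB d g g' x : continuous g -> continuous g' ->
  avg d (fun x => g x - g' x) x = avg d g x - avg d g' x.
Proof.
move=> cg cg'; rewrite /avg; under eq_fun do rewrite mulrBr.
by rewrite (intRnB rho0) //; exact: Cc_ball_avg_integrand.
Qed.

Lemma avg_norm_le d g B x : continuous g -> (forall x, `|g x| <= B) ->
  `|avg d g x| <= B.
Proof. by move=> cg gB; apply: mean_norm_le => //; exact: continuous_affine. Qed.

Lemma avg_continuous d g : continuous g -> continuous (avg d g).
Proof.
move=> cg; apply: dist_continuous => x e e0.
have [c c0 gc] := continuous_ball_unif (@balls_compact_rV R n) (`|d| * rho + `|x|) cg e0.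
exists c => // y xy; have cgt z := Cc_ball_avg_integrand d z cg.
rewrite -(intRnB rho0 (cgt x) (cgt y)); under eq_fun do rewrite -mulrBr.
apply: mean_norm_le => [u|u uK].
  by apply: continuousB; exact: continuous_affine.
apply: gc; last by rewrite opprD addrACA subrr add0r.
by apply: le_trans (ler_normD _ _) _; rewrite lerD2r normrZ ler_wpM2l.
Qed.

Lemma avg_sum (I : eqType) (r : seq I) (c : I -> R) (F : I -> pt -> R) d x :
  (forall i, continuous (F i)) ->
  avg d (fun x => \sum_(i <- r) c i * F i x) x = \sum_(i <- r) c i * avg d (F i) x.
Proof.
move=> cF; rewrite /avg; under eq_fun do rewrite mulr_sumr.
rewrite (intRn_sum (K := rho) rho0) => [|i _]; last first.
  under eq_fun do rewrite mulrCA.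
  by apply: Cc_ballZ; exact: Cc_ball_avg_integrand.
apply: eq_bigr => i _; under eq_fun do rewrite mulrCA.
by rewrite (intRnZ _ rho0)//; exact: Cc_ball_avg_integrand.
Qed.

Lemma avgC d e g : continuous g -> avg d (avg e g) = avg e (avg d g).
Proof.
move=> cg; apply/funext => x.
have avg2E (a b : R) : avg a (avg b g) x =
    intRn (fun u => intRn (fun v => th u * th v * g (a *: u + b *: v + x))).
  congr intRn; apply/funext => u; rewrite -(intRnZ (th u) rho0).
    by congr intRn; apply/funext => v; rewrite mulrA addrCA addrA.
  exact: Cc_ball_avg_integrand.
rewrite !avg2E (intRn_swap (K := rho)
  (G := fun v u => th u * th v * g (d *: u + e *: v + x)))//.
  congr intRn; apply/funext => v; congr intRn; apply/funext => u.
  by rewrite [th v * _]mulrC [e *: v + _]addrC.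
under eq_fun do rewrite [th _ * th _]mulrC [d *: _ + _]addrC.
by apply: Cc_ball_prod => //; exact: continuous_lincomb.
Qed.

Lemma avg_integrand_eq0 K d g x u : (forall y, K < `|y| -> g y = 0) ->
  K + `|d| * rho < `|x| -> th u * g (d *: u + x) = 0.
Proof.
move=> g0 Kx; have [uK|/cth.2 ->] := leP `|u| rho; last by rewrite mul0r.
rewrite g0 ?mulr0//.
have := ler_wpM2l (normr_ge0 d) uK; rewrite -normrZ.
by have := ler_normB (d *: u + x) (d *: u); rewrite addrAC subrr add0r; lra.
Qed.

Lemma Cc_ball_avg K d g : Cc_ball K g -> Cc_ball (K + `|d| * rho) (avg d g).
Proof.
move=> [cg g0]; split => [|x Kx]; first exact: avg_continuous.
by rewrite /avg; under eq_fun do rewrite (avg_integrand_eq0 _ g0 Kx); exact: intRn0.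
Qed.

Lemma avg_adjoint K d g ps : 0 <= K -> continuous g -> Cc_ball K ps ->
  intRn (fun x => avg d g x * ps x) = intRn (fun x => g x * avg (- d) ps x).
Proof.
move=> K0 cg cps; pose K1 := K + `|d| * rho + rho.
have KK1 : K <= K1 by rewrite /K1 -addrA lerDl addr_ge0 ?mulr_ge0.
have rK1 : rho <= K1 by rewrite lerDr addr_ge0 ?mulr_ge0.
have K10 : 0 <= K1 by exact: le_trans KK1.
have cth1 := Cc_ballW rK1 cth; have cps1 := Cc_ballW KK1 cps.
have cl : Cc_ball K1 (fun p : pt * pt => ps p.1 * th p.2 * g (d *: p.2 + p.1)).
  by apply: Cc_ball_prod => //; exact: continuous_shear.
pose H x u := g x * (th u * ps (- d *: u + x)).
have cr : Cc_ball K1 (fun p : pt * pt => H p.1 p.2).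
  split => [p|[x u]].
    have cthps := continuousM (continuous_comp_snd (V := pt) cth.1 p)
      (continuous_shear (- d) cps.1 p).
    exact: continuousM (continuous_comp_fst cg p) cthps.
  rewrite prod_normE/= lt_max /H => /orP[Kx|/cth1.2 ->]; last by rewrite mul0r mulr0.
  rewrite (@avg_integrand_eq0 K) ?mulr0// => [y|]; first exact: cps.2.
  by rewrite normrN; apply: le_lt_trans Kx; rewrite lerDl.
have lhsE : intRn (fun x => avg d g x * ps x) =
    intRn (fun x => intRn (fun u => ps x * th u * g (d *: u + x))).
  congr intRn; apply/funext => x; rewrite mulrC -(intRnZ _ rho0) /=.
    by congr intRn; apply/funext => u; rewrite mulrA.
  exact: Cc_ball_avg_integrand.
have rhsE : intRn (fun x => g x * avg (- d) ps x) =
    intRn (fun x => intRn (H x)).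
  congr intRn; apply/funext => x; rewrite -(intRnZ _ rho0)//.
  by apply: Cc_ball_avg_integrand; exact: cps.1.
rewrite lhsE rhsE -(intRn_swap K10 cl) -(intRn_swap K10 cr).
congr intRn; apply/funext => u.
have cHu := Cc_ball_curry (G := fun u x => H x u) u (Cc_ball_swap cr).
rewrite -[RHS](intRn_translate (d *: u) K10 cHu); congr intRn; apply/funext => x /=.
by rewrite /H scaleNr [x + _]addrC addKr mulrC [ps x * _]mulrC.
Qed.

Lemma avg_vanishing_moments_le p K ps : 0 <= K -> CL p th -> Cc_ball K ps ->
  vanishing_moments p ps ->
  exists2 C, 0 <= C & forall d z, d != 0 -> `|avg d ps z| <= C * `|d| ^- n * `|d| ^- p.
Proof.
move=> K0 Cth cps vps; have [C C0 thC] := dilated_pairing_le K0 Cth cth cps vps.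
exists C => // d z d0; pose F x := th (d^-1 *: x + - (d^-1 *: z)) * ps x.
have cF : Cc_ball K F by apply: Cc_ballMl => //; exact: continuous_affine cth.1.
have -> : avg d ps z = intRn (fun u => F (d *: u + z)).
  congr intRn; apply/funext => u.
  by rewrite /F scalerDr scalerA mulVf// scale1r addrK.
rewrite (intRn_affine z K0 d0 cF) normrM ger0_norm ?invr_ge0 ?exprn_ge0//.
rewrite mulrC mulrAC ler_wpM2r ?invr_ge0 ?exprn_ge0//.
by apply: le_trans (thC _ _) _; rewrite normfV exprVn.
Qed.

Lemma intRn_avg_le p K ps : 0 <= K -> CL p th -> Cc_ball K ps ->
  vanishing_moments p ps ->
  exists2 C, 0 <= C & forall d g B, 1 <= d -> continuous g -> (forall x, `|g x| <= B) ->
    `|intRn (fun x => avg d g x * ps x)| <= C * B * d ^- p.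
Proof.
move=> K0 Cth cps vps; have [C C0 avgC] := avg_vanishing_moments_le K0 Cth cps vps.
exists ((2 * (K + rho)) ^+ n * C) => [|d g B d1 cg gB].
  by rewrite mulr_ge0// exprn_ge0// mulr_ge0// addr_ge0.
have d0 : 0 < d by exact: lt_le_trans d1.
have Nd0 : - d != 0 by rewrite oppr_eq0 gt_eqF.
have cavgN := Cc_ball_avg (- d) cps; rewrite normrN gtr0_norm// in cavgN.
have Kd0 : 0 <= K + d * rho by rewrite addr_ge0// mulr_ge0// ltW.
have Kd : K + d * rho <= (K + rho) * d by rewrite mulrDl [d * _]mulrC lerD2r ler_peMr.
rewrite (avg_adjoint d K0 cg cps).
apply: le_trans (intRn_norm_le (e := B * (C * d ^- n * d ^- p)) Kd0 (Cc_ballMl cg cavgN) _) _.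
  move=> x; rewrite normrM; apply: ler_pM => //.
  by have := avgC _ x Nd0; rewrite normrN (gtr0_norm d0).
apply: (@le_trans _ _ (((2 * (K + rho)) * d) ^+ n * (B * (C * d ^- n * d ^- p)))).
  have B0 : 0 <= B by exact: le_trans (normr_ge0 _) (gB 0).
  apply: ler_wpM2r; first by rewrite !mulr_ge0 ?invr_ge0 ?exprn_ge0 ?(ltW d0).
  apply: lerXn2r; rewrite ?nnegrE; last by rewrite -mulrA ler_wpM2l.
    by rewrite mulr_ge0.
  by rewrite !mulr_ge0 ?addr_ge0 ?(ltW d0).
rewrite [leLHS](_ : _ = (2 * (K + rho)) ^+ n * C * B * d ^- p)// exprMn.
by field; rewrite !expf_neq0 ?gt_eqF.
Qed.

Lemma norm_sum_sign_bin_le k (a : nat -> R) B : 0 <= B -> (forall m, `|a m| <= B) ->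
  `|\sum_(m < k) (-1) ^+ m * 'C(k, m.+1)%:R * a m| <= 2 ^+ k * B.
Proof.
move=> B0 aB; apply: le_trans (ler_norm_sum _ _ _) _.
apply: (@le_trans _ _ (\sum_(m < k) 'C(k, m.+1)%:R * B)).
  apply: ler_sum => m _; rewrite !normrM normrX normrN1 expr1n mul1r normr_nat.
  by rewrite ler_wpM2l.
rewrite -mulr_suml ler_wpM2r// -[2]/(1 + 1) exprDn big_ord_recl/=.
rewrite ler_wpDl ?mulrn_wge0 ?mulr_ge0 ?exprn_ge0//.
by apply: ler_sum => m _; rewrite !expr1n mul1r lexx.
Qed.

(* Subtracting [cavg k d g] from [g] leaves the mean of the [k]-th differences of [g] with
   steps [d *: u]. *)
Definition cavg k d g x :=
  \sum_(m < k) (-1) ^+ m * 'C(k, m.+1)%:R * avg (m.+1%:R * d) g x.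

Lemma cavgB k d g g' x : continuous g -> continuous g' ->
  cavg k d (fun x => g x - g' x) x = cavg k d g x - cavg k d g' x.
Proof.
by move=> cg cg'; rewrite -sumrB; apply: eq_bigr => m _; rewrite avgB// mulrBr.
Qed.

Lemma cavg_continuous k d g : continuous g -> continuous (cavg k d g).
Proof.
move=> cg; apply: continuous_big => [|m _]; first exact: add_continuous.
by apply: continuous_cstM; exact: avg_continuous.
Qed.

Lemma cavg_norm_le k d g B x : continuous g -> (forall x, `|g x| <= B) ->
  `|cavg k d g x| <= 2 ^+ k * B.
Proof.
move=> cg gB; apply: (@norm_sum_sign_bin_le k (fun m => avg (m.+1%:R * d) g x)) => [|m].
  exact: le_trans (normr_ge0 _) (gB 0).
exact: avg_norm_le.
Qed.

Lemma cavgC k d e g : continuous g -> cavg k d (cavg k e g) = cavg k e (cavg k d g).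
Proof.
move=> cg; apply/funext => x; pose c (m : 'I_k) : R := (-1) ^+ m * 'C(k, m.+1)%:R.
have cavg2E a b : cavg k a (cavg k b g) x =
    \sum_(i < k) \sum_(j < k) c i * (c j * avg (i.+1%:R * a) (avg (j.+1%:R * b) g) x).
  apply: eq_bigr => i _; rewrite -mulr_sumr; congr (_ * _); apply: avg_sum => j.
  exact: avg_continuous.
rewrite !cavg2E exchange_big; apply: eq_bigr => i _; apply: eq_bigr => j _.
by rewrite avgC// mulrCA.
Qed.

Lemma cavg_approx k d g e x : continuous g ->
  (forall u, `|u| <= rho -> forall y, `|sdiffn k (d *: u) g y| <= e) ->
  `|g x - cavg k d g x| <= e.
Proof.
move=> cg ge.
pose D u := (-1) ^+ k * sdiffn k (d *: u) g (x + (k%:R / 2) *: (d *: u)).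
have DE : D = fun u =>
    g x - \sum_(m < k) (-1) ^+ m * 'C(k, m.+1)%:R * g ((m.+1%:R * d) *: u + x).
  apply/funext => u; rewrite /D sdiffn_forward big_ord_recl/= scale0r addr0 bin0 expr0.
  rewrite !mul1r -sumrN.
  congr (_ + _); apply: eq_bigr => m _; rewrite /fintype.bump/= add1n.
  by rewrite scalerA [x + _]addrC exprS mulN1r !mulNr.
pose c m : R := (-1) ^+ m * 'C(k, m.+1)%:R.
have cterm (m : 'I_k) : Cc_ball rho (fun u => c m * (th u * g ((m.+1%:R * d) *: u + x))).
  by apply: Cc_ballZ; exact: Cc_ball_avg_integrand.
have csum : Cc_ball rho (fun u => \sum_(m < k) c m * (th u * g ((m.+1%:R * d) *: u + x))).
  exact: Cc_ball_sum.
have -> : g x - cavg k d g x = intRn (fun u => th u * D u).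
  rewrite DE; under [in RHS]eq_fun do rewrite mulrBr mulrC mulr_sumr.
  under [in RHS]eq_fun do under eq_bigr do rewrite mulrCA.
  rewrite (intRnB rho0 (Cc_ballZ (g x) cth) csum) (intRnZ _ rho0 cth) th1 mulr1.
  rewrite (intRn_sum rho0 (fun m _ => cterm m)); congr (_ - _).
  by apply: eq_bigr => m _; rewrite (intRnZ _ rho0)//; exact: Cc_ball_avg_integrand.
apply: mean_norm_le => [|u uK]; last first.
  by rewrite normrM normrX normrN1 expr1n mul1r; exact: ge.
rewrite DE => u; apply: continuousB; first exact: cst_continuous.
move: u; apply: continuous_big => [|m _]; first exact: add_continuous.
by apply: continuous_cstM; exact: continuous_affine.
Qed.

Lemma intRn_cavg_le k p K ps : 0 <= K -> CL p th -> Cc_ball K ps ->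
  vanishing_moments p ps ->
  exists2 C, 0 <= C & forall d g B, 1 <= d -> continuous g -> (forall x, `|g x| <= B) ->
    `|intRn (fun x => cavg k d g x * ps x)| <= C * B * d ^- p.
Proof.
move=> K0 Cth cps vps; have [C C0 psC] := intRn_avg_le K0 Cth cps vps.
exists (2 ^+ k * C) => [|d g B d1 cg gB]; first by rewrite mulr_ge0// exprn_ge0.
have d0 : 0 < d by exact: lt_le_trans d1.
have B0 : 0 <= B by exact: le_trans (normr_ge0 _) (gB 0).
have cavgps c : Cc_ball K (fun x => avg c g x * ps x).
  by apply: Cc_ballMl => //; exact: avg_continuous.
under eq_fun do rewrite mulr_suml.
rewrite (intRn_sum (K := K) K0) => [|m _]; last first.
  under eq_fun do rewrite -mulrA.
  exact: Cc_ballZ.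
under eq_bigr => m _ do
  (under eq_fun do rewrite -mulrA; rewrite (intRnZ _ K0 (cavgps _))).
rewrite -2!mulrA; apply: (@norm_sum_sign_bin_le k
  (fun m => intRn (fun x => avg (m.+1%:R * d) g x * ps x))) => [|m].
  by rewrite !mulr_ge0// invr_ge0 exprn_ge0// ltW.
have md : d <= m.+1%:R * d by rewrite ler_peMl ?(ltW d0)// ler1n.
apply: le_trans (psC _ _ _ (le_trans d1 md) cg gB) _.
rewrite -mulrA !ler_wpM2l// lef_pV2 ?posrE ?exprn_gt0 ?(lt_le_trans d0 md)//.
by rewrite lerXn2r ?nnegrE ?(ltW d0) ?(le_trans (ltW d0) md).
Qed.

End Averages.

(** * Decay of wavelet coefficients *)

Section GeometricSums.
Context {R : realType}.
Implicit Types (q a e : R).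

Lemma sum_geometric_le q i : 0 < q -> q < 1 -> \sum_(t < i) q ^+ t <= (1 - q)^-1.
Proof.
move=> q0 q1; rewrite -[leRHS]mul1r; apply: le_trans (geometric_le_lim i ler01 q0 _).
  by rewrite /series/= big_mkord; apply: ler_sum => t _; rewrite mul1r.
by rewrite gtr0_norm.
Qed.

Lemma exprn_small q e : 0 <= q -> q < 1 -> 0 < e -> exists m, q ^+ m <= e.
Proof.
move=> q0 q1 e0.
have /cvgrPdist_le/(_ _ e0)[m _ qm] : (q ^+ n @[n --> \oo] --> (0 : R)).
  by apply: cvg_expr; rewrite ger0_norm.
exists m; have := qm m (leqnn m).
by rewrite sub0r normrN ger0_norm// exprn_ge0.
Qed.

End GeometricSums.

Section PairingDecay.
Context {R : realType} {n : nat}.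
Local Notation pt := 'rV[R]_n.
Variables (rho : R) (th : pt -> R).
Hypothesis kerth : averaging_kernel rho th.
Variables (K : R) (ps : pt -> R).
Hypotheses (K0 : 0 <= K) (cps : Cc_ball K ps).
Variables (k p : nat) (sg : R).
Hypotheses (sg1 : 1 <= sg) (sgp : sg < 2 ^+ p).
Implicit Types (B C D G : R) (x u : pt) (g : pt -> R) (t i : nat).

Let A t g := cavg th k (2 ^+ t) g.
Let J g : R := intRn (fun x => g x * ps x).

Let cA t g : continuous g -> continuous (A t g).
Proof. by move=> cg; apply: (cavg_continuous kerth). Qed.

Let JB g g' : continuous g -> continuous g' -> J (fun x => g x - g' x) = J g - J g'.
Proof.
move=> cg cg'; rewrite /J -(intRnB K0 (Cc_ballMl cg cps) (Cc_ballMl cg' cps)).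
by under eq_fun do rewrite mulrBl.
Qed.

Definition dyadic_sdiffn_le g D : Prop := forall t u, `|u| <= rho ->
  forall y, `|sdiffn k (2 ^+ t *: u) g y| <= D * sg ^+ t.

Lemma dyadic_sdiffn_le_ge0 g D : dyadic_sdiffn_le g D -> 0 <= D.
Proof.
have [rho0 _ _ _] := kerth; move=> /(_ 0 0); rewrite normr0 expr0 mulr1 => /(_ rho0 0).
exact: le_trans.
Qed.

Lemma dyadic_cavg_approx g D t x : continuous g -> dyadic_sdiffn_le g D ->
  `|g x - A t g x| <= D * sg ^+ t.
Proof. by move=> cg gD; apply: (cavg_approx kerth) => //; exact: gD. Qed.

Lemma pairing_cavg_start g D B : continuous g -> dyadic_sdiffn_le g D ->
  (forall x, `|ps x| <= B) ->
  `|J g - J (A 0 (A 0 g))| <= (2 * K) ^+ n * ((1 + 2 ^+ k) * B) * D.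
Proof.
move=> cg gD psB; pose g0 x := g x - A 0 g x.
have cg0 : continuous g0 by move=> x; apply: continuousB; [exact: cg|exact: cA].
have g0D x : `|g0 x| <= D.
  by have := dyadic_cavg_approx 0 x cg gD; rewrite expr0 mulr1.
rewrite -JB//; last by apply: cA; exact: cA.
rewrite -mulrA; apply: intRn_norm_le => // [|x].
  apply: Cc_ballMl => // x; apply: continuousB; first exact: cg.
  by apply: cA; exact: cA.
rewrite normrM mulrAC; apply: ler_pM => //.
rewrite (_ : g x - _ = g0 x + A 0 g0 x); last first.
  by rewrite /A (cavgB kerth) -?/(A _ _) ?/g0 ?addrA ?subrK//; exact: cA.
apply: le_trans (ler_normD _ _) _; rewrite mulrDl mul1r.
by apply: lerD => //; exact: (cavg_norm_le kerth).
Qed.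

Variable C : R.
Hypothesis C0 : 0 <= C.
Hypothesis pairing_cavg_le : forall d g B, 1 <= d -> continuous g ->
  (forall x, `|g x| <= B) -> `|J (cavg th k d g)| <= C * B * d ^- p.

Let dyadic_pairing_le t g B : continuous g -> (forall x, `|g x| <= B) ->
  `|J (A t g)| <= C * B * (2 ^- p) ^+ t.
Proof.
move=> cg gB; have := @pairing_cavg_le (2 ^+ t) g B _ cg gB.
by rewrite -exprM mulnC exprM exprVn; apply; apply: exprn_ege1; rewrite ler1n.
Qed.

Lemma pairing_cavg_step g D t : continuous g -> dyadic_sdiffn_le g D ->
  `|J (A t (A t g)) - J (A t.+1 (A t.+1 g))| <= 4 * C * sg * D * (sg / 2 ^+ p) ^+ t.
Proof.
move=> cg gD; pose gt x := A t g x - A t.+1 g x.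
have D0 := dyadic_sdiffn_le_ge0 gD.
have cgt : continuous gt by move=> x; apply: continuousB; exact: cA.
have gtD x : `|gt x| <= 2 * D * sg ^+ t.+1.
  have -> : gt x = (g x - A t.+1 g x) - (g x - A t g x) by rewrite /gt; ring.
  apply: le_trans (ler_normB _ _) _.
  have := dyadic_cavg_approx t x cg gD; have := dyadic_cavg_approx t.+1 x cg gD.
  have : D * sg ^+ t <= D * sg ^+ t.+1 by rewrite ler_wpM2l// ler_weXn2l.
  lra.
have -> : J (A t (A t g)) - J (A t.+1 (A t.+1 g)) = J (A t gt) + J (A t.+1 gt).
  have cAA a b : continuous (A a (A b g)) by apply: cA; exact: cA.
  have Agt a : A a gt = fun x => A a (A t g) x - A a (A t.+1 g) x.
    by apply/funext => x; rewrite /A (cavgB kerth)//; exact: cA.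
  have commA : A t.+1 (A t g) = A t (A t.+1 g) by apply: (cavgC kerth).
  by rewrite !Agt !JB// commA addrA subrK.
have B0 : 0 <= C * (2 * D * sg ^+ t.+1) by rewrite !mulr_ge0// exprn_ge0// (le_trans _ sg1).
have := dyadic_pairing_le t cgt gtD; have := dyadic_pairing_le t.+1 cgt gtD.
have : C * (2 * D * sg ^+ t.+1) * (2 ^- p) ^+ t.+1 <= C * (2 * D * sg ^+ t.+1) * (2 ^- p) ^+ t.
  rewrite ler_wpM2l// exprSr ler_piMr ?exprn_ge0 ?invr_ge0//.
  by rewrite invf_le1 ?exprn_gt0// exprn_ege1// ler1n.
have -> : 4 * C * sg * D * (sg / 2 ^+ p) ^+ t = 2 * (C * (2 * D * sg ^+ t.+1) * (2 ^- p) ^+ t).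
  by rewrite exprMn exprS; ring.
by have := ler_normD (J (A t gt)) (J (A t.+1 gt)); lra.
Qed.

Lemma pairing_cavg_end g G i : continuous g -> (forall x, `|g x| <= G) ->
  `|J (A i (A i g))| <= C * (2 ^+ k * G) * (2 ^- p) ^+ i.
Proof.
by move=> cg gG; apply: dyadic_pairing_le => [|x]; [exact: cA|exact: (cavg_norm_le kerth)].
Qed.

Lemma pairing_le g G D B : continuous g -> (forall x, `|g x| <= G) ->
  dyadic_sdiffn_le g D -> (forall x, `|ps x| <= B) ->
  `|J g| <= ((2 * K) ^+ n * ((1 + 2 ^+ k) * B) + 4 * C * sg / (1 - sg / 2 ^+ p)) * D.
Proof.
move=> cg gG gD psB; pose q := sg / 2 ^+ p.
have sg0 : 0 < sg by exact: lt_le_trans sg1.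
have D0 := dyadic_sdiffn_le_ge0 gD.
have G0 : 0 <= G by exact: le_trans (normr_ge0 _) (gG 0).
have q0 : 0 < q by rewrite divr_gt0// exprn_gt0.
have q1 : q < 1 by rewrite ltr_pdivrMr ?exprn_gt0// mul1r.
have telescope i : J g = (J g - J (A 0 (A 0 g)))
    + \sum_(t < i) (J (A t (A t g)) - J (A t.+1 (A t.+1 g))) + J (A i (A i g)).
  have := telescope_sumr (fun t => - J (A t (A t g))) (leq0n i).
  under eq_bigr do rewrite opprK addrC.
  by rewrite big_mkord => ->; ring.
apply/ler_addgt0Pl => e e0.
have CG0 : 0 <= C * (2 ^+ k * G) by rewrite !mulr_ge0// exprn_ge0.
have p21 : 2 ^- p < 1 :> R.
  by rewrite invf_lt1 ?exprn_gt0//; exact: le_lt_trans sgp.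
have p20 : 0 <= 2 ^- p :> R by rewrite invr_ge0 exprn_ge0.
have [i ie] := exprn_small p20 p21 (divr_gt0 e0 (ltr_wpDl CG0 ltr01)).
have steps : `|\sum_(t < i) (J (A t (A t g)) - J (A t.+1 (A t.+1 g)))|
    <= 4 * C * sg / (1 - q) * D.
  apply: le_trans (ler_norm_sum _ _ _) _.
  apply: (@le_trans _ _ (\sum_(t < i) 4 * C * sg * D * q ^+ t)).
    by apply: ler_sum => t _; exact: pairing_cavg_step.
  rewrite -mulr_sumr [leRHS]mulrAC ler_wpM2l ?sum_geometric_le//.
  by rewrite !mulr_ge0// ltW.
have tail : `|J (A i (A i g))| <= e.
  apply: le_trans (pairing_cavg_end i cg gG) _.
  by apply: le_trans (ler_wpM2l CG0 ie) _; rewrite mul_div_addr1_le// ltW.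
rewrite (telescope i) mulrDl addrC; apply: le_trans (ler_normD _ _) _.
apply: lerD => //; apply: le_trans (ler_normD _ _) _.
by apply: lerD => //; exact: pairing_cavg_start.
Qed.

End PairingDecay.

Lemma pairing_decay (R : realType) (n : nat) (rho : R) (th : 'rV[R]_n -> R) (K : R)
    (ps : 'rV[R]_n -> R) (k p : nat) (sg : R) :
  averaging_kernel rho th -> CL p th -> 0 <= K -> Cc_ball K ps ->
  vanishing_moments p ps -> 1 <= sg -> sg < 2 ^+ p ->
  exists2 C, 0 <= C & forall (g : 'rV[R]_n -> R) (D G : R), continuous g ->
    (forall x, `|g x| <= G) -> dyadic_sdiffn_le rho k sg g D ->
    `|intRn (fun x => g x * ps x)| <= C * D.
Proof.
move=> kerth Cth K0 cps vps sg1 sgp.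
have [C C0 cavgC] := intRn_cavg_le kerth k K0 Cth cps vps.
have [B B0 psB] := Cc_ball_bounded (@balls_compact_rV R n) cps.
exists ((2 * K) ^+ n * ((1 + 2 ^+ k) * B) + 4 * C * sg / (1 - sg / 2 ^+ p))
  => [|g D G cg gG gD].
  apply: addr_ge0; first by rewrite !mulr_ge0 ?exprn_ge0 ?mulr_ge0 ?addr_ge0 ?exprn_ge0.
  rewrite !mulr_ge0 ?(le_trans ler01 sg1)// invr_ge0 subr_ge0.
  by rewrite ler_pdivrMr ?exprn_gt0// mul1r ltW.
exact: (pairing_le kerth K0 cps sg1 sgp C0 cavgC cg gG gD psB).
Qed.

Section HolderZygmund.
Context {R : realType} {n : nat}.
Local Notation pt := 'rV[R]_n.
Implicit Types (a s y e : R) (x h : pt) (f : pt -> R) (r t : nat).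

Lemma enorm_ge0 x : 0 <= enorm x.
Proof. exact: sqrtr_ge0. Qed.

Lemma norm_le_enorm x : `|x| <= enorm x.
Proof.
have S0 : 0 <= \sum_(i < n) x ord0 i ^+ 2 by apply: sumr_ge0 => i _; exact: sqr_ge0.
apply: rV_norm_le (enorm_ge0 x) _ => i; rewrite -sqrtr_sqr ler_sqrt//.
by apply: (le_sum_term (F := fun i => x ord0 i ^+ 2)) => j; exact: sqr_ge0.
Qed.

Lemma enorm_sqr_le x : enorm x ^+ 2 <= n%:R * `|x| ^+ 2.
Proof.
rewrite sqr_sqrtr; last by apply: sumr_ge0 => i _; exact: sqr_ge0.
rewrite -[n in n%:R]card_ord -sum1_card natr_sum mulr_suml; apply: ler_sum => i _.
by rewrite mul1r -real_normK ?num_real// ler_sqr ?nnegrE// coord_norm_le.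
Qed.

Lemma enorm_le x : enorm x <= n%:R * `|x|.
Proof.
have n0 : 0 <= n%:R * `|x| :> R by rewrite mulr_ge0.
rewrite -ler_sqr ?nnegrE ?enorm_ge0//; apply: le_trans (enorm_sqr_le x) _.
rewrite exprMn ler_wpM2r ?sqr_ge0// expr2.
by case: n => [|k]; rewrite ?mulr0// ler_peMr// ler1n.
Qed.

Lemma enorm_eq0 x : enorm x = 0 -> x = 0.
Proof. by move=> x0; apply/eqP; rewrite -normr_le0 -x0 norm_le_enorm. Qed.

Lemma exprn_powR a s t : 0 <= a -> (a ^+ t) `^ s = (a `^ s) ^+ t.
Proof.
by move=> a0; rewrite -(powR_mulrn t a0) -(powR_mulrn t (powR_ge0 a s)) -!powRrM mulrC.
Qed.

Lemma invr_powR a s : 0 < a -> a^-1 `^ s = (a `^ s)^-1.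
Proof. by move=> a0; rewrite -powR_inv1 ?(ltW a0)// -powRrM mulN1r powRN. Qed.

Lemma powR2_gt1 s : 0 < s -> 1 < 2 `^ s :> R.
Proof.
by move=> s0; rewrite -[ltLHS]expR0 /powR pnatr_eq0/= ltr_expR mulr_gt0// ln_gt0// ltr1n.
Qed.

Lemma powR2_lt_exprn s t : s < t%:R -> 2 `^ s < 2 ^+ t :> R.
Proof.
move=> st; rewrite -powR_mulrn// /powR pnatr_eq0/= ltr_expR ltr_pM2r//.
by rewrite ln_gt0// ltr1n.
Qed.

Lemma DeltaR_ge r f x h B : (forall x, `|f x| <= B) ->
  `|sdiffn r h f x| <= DeltaR r f x (enorm h).
Proof.
move=> fB; apply: ub_le_sup; last by exists h.
by exists (2 ^+ r * B) => _ [h' _ <-]; exact: sdiffn_norm_le.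
Qed.

Lemma DeltaR_gt r f x y e : 0 <= e -> e < DeltaR r f x y ->
  exists2 h, enorm h = y & e < `|sdiffn r h f x|.
Proof.
rewrite /DeltaR; set S := [set _ | _ in _] => e0 eS.
have [hS|/sup_out S0] := pselect (has_sup S); last by move: eS; rewrite S0 ltNge e0.
have eS0 : 0 < sup S - e by rewrite subr_gt0.
by have [_ [h /= hy <-]] := sup_adherent eS0 hS; rewrite subKr; exists h.
Qed.

Lemma Lambda_sdiffn_le s f : 0 < s -> in_Lambda s f ->
  exists2 C : R, 0 <= C &
    forall h x, `|sdiffn (Num.truncn s).+1 h f x| <= C * enorm h `^ s.
Proof.
move=> s0 [_ [[B fB] [C fC]]]; set k := (Num.truncn s).+1 in fC *.
have B0 : 0 <= B by exact: le_trans (normr_ge0 _) (fB 0).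
have kB : 0 <= 2 ^+ k * B by rewrite mulr_ge0// exprn_ge0.
exists (`|C| + 2 ^+ k * B) => [|h x]; first by rewrite addr_ge0.
have [h0|hn0] := eqVneq (enorm h) 0.
  by rewrite (enorm_eq0 h0) sdiffn0 normr0 mulr_ge0 ?addr_ge0 ?powR_ge0.
have hp : 0 < enorm h by rewrite lt_neqAle eq_sym hn0 enorm_ge0.
have [h1|h1] := leP (enorm h) 1.
  have := fC x (enorm h); rewrite hp h1 ler_pdivrMr ?powR_gt0// => /(_ isT) DC.
  apply: le_trans (DeltaR_ge _ _ _ fB) _; apply: le_trans DC _.
  by rewrite ler_wpM2r ?powR_ge0// (le_trans (ler_norm C))// lerDl.
apply: le_trans (sdiffn_norm_le k h fB x) _; rewrite mulrDl.
apply: (@le_trans _ _ (2 ^+ k * B * enorm h `^ s)); last first.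
  by rewrite lerDr mulr_ge0 ?powR_ge0.
by rewrite ler_peMr// -(powRr0 (enorm h)) ler_powR ?(ltW h1)// ltW.
Qed.

Lemma dyadic_sdiffn_le_affine f C s rho a b k : 0 <= C -> 0 <= s -> 0 <= a ->
  (forall h x, `|sdiffn k h f x| <= C * enorm h `^ s) ->
  dyadic_sdiffn_le rho k (2 `^ s) (fun x => f (a *: x + b)) (C * (n%:R * rho) `^ s * a `^ s).
Proof.
move=> C0 s0 a0 fC t u urho y; rewrite sdiffn_affine.
have rho0 : 0 <= rho by exact: le_trans urho.
apply: le_trans (fC _ _) _; rewrite -!mulrA ler_wpM2l//.
rewrite -exprn_powR// -!powRM ?mulr_ge0 ?exprn_ge0//.
apply: ge0_ler_powR => //; rewrite ?nnegrE ?enorm_ge0 ?mulr_ge0 ?exprn_ge0//.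
apply: le_trans (enorm_le _) _; rewrite -mulrA ler_wpM2l// !normrZ !ger0_norm ?exprn_ge0//.
by rewrite [leRHS]mulrC -mulrA !ler_wpM2l ?exprn_ge0.
Qed.

End HolderZygmund.

Section Wavelets.
Context {R : realType} {n : nat}.
Local Notation pt := 'rV[R]_n.
Implicit Types (x h : pt) (f g : pt -> R) (l i : nat) (k : 'rV[int]_n).

Lemma compact_support_Cc_ball g : continuous g -> compact_support g ->
  exists2 K, 0 <= K & Cc_ball K g.
Proof.
move=> cg [M gM]; exists `|M| => //; split => // x Mx; apply: gM.
by apply: le_lt_trans (ler_norm M) _; apply: lt_le_trans Mx (norm_le_enorm x).
Qed.

Lemma Cc_ball_compact_support (K : R) g : 0 <= K -> Cc_ball K g -> compact_support g.
Proof.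
move=> K0 [_ g0]; exists (n%:R * K) => x Kx; apply: g0; rewrite ltNge; apply/negP => xK.
by have := lt_le_trans Kx (enorm_le x); rewrite ltNge ler_wpM2l.
Qed.

Lemma Omega_lt l i k : Omega (l, i, k) -> (l < 2 ^ n)%N.
Proof.
move=> [[/= -> _]|/= /andP[_]]; first by rewrite expn_gt0.
by rewrite subn1 => /leq_ltn_trans; apply; rewrite prednK ?expn_gt0.
Qed.

Lemma psi_index l : (0 < l)%N -> (l < 2 ^ n)%N -> (1 <= l <= 2 ^ n - 1)%N.
Proof. by move=> -> ln; rewrite subn1 -ltnS prednK ?expn_gt0. Qed.

Lemma Omega0 i k : Omega (0%N, i, k) -> i = 0%N.
Proof. by case=> -[]. Qed.

Definition amplitude i : R := 2 `^ ((i * n)%:R / 2).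

Lemma amplitude_gt0 i : 0 < amplitude i.
Proof. by rewrite powR_gt0. Qed.

Lemma amplitude_sqr i : amplitude i * amplitude i = (2 ^+ i) ^+ n.
Proof.
rewrite /amplitude -powRD; last by apply/implyP => _; rewrite pnatr_eq0.
by rewrite -splitr powR_mulrn// exprM.
Qed.

Lemma amplitude0 : amplitude 0 = 1.
Proof. by rewrite /amplitude mul0n mul0r powRr0. Qed.

Lemma amplitudeM_powR (s : R) i : (0 < n)%N ->
  (2 ^- (i * n)) `^ (s / n%:R + 2^-1) * amplitude i = (2 `^ s) ^- i.
Proof.
move=> n0; have nR : n%:R != 0 :> R by rewrite pnatr_eq0 -lt0n.
rewrite invr_powR ?exprn_gt0// -!powR_mulrn ?powR_ge0// -!powRrM /amplitude natrM.
rewrite -!powRN -powRD; last by apply/implyP => _; rewrite pnatr_eq0.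
by congr (_ `^ _); field.
Qed.

Variables (L : nat) (phi : pt -> R) (psi : nat -> pt -> R).
Hypothesis dau : daubechies L phi psi.

Definition atom l : pt -> R := if l == 0%N then phi else psi l.

Lemma wav_atom l i k : Omega (l, i, k) ->
  wav phi psi (l, i, k) = (fun x => amplitude i * atom l (2 ^+ i *: x + - intv R k)).
Proof.
rewrite /wav /atom; case: eqP => [->/Omega0 ->|//].
by apply/funext => x; rewrite amplitude0 expr0 scale1r mul1r.
Qed.

Lemma atom_CL l : (l < 2 ^ n)%N -> CL L (atom l).
Proof.
have [[Cphi _] Cpsi _ _ _] := dau; rewrite /atom => ln; case: eqP => // /eqP.
by rewrite -lt0n => /psi_index/(_ ln)/Cpsi[].
Qed.

Lemma atom_Cc_ball l : (l < 2 ^ n)%N -> exists2 K, 0 <= K & Cc_ball K (atom l).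
Proof.
move=> ln; apply: compact_support_Cc_ball; first exact: CL_continuous (atom_CL ln).
have [[_ sphi] Cpsi _ _ _] := dau; rewrite /atom; case: eqP => // /eqP.
by rewrite -lt0n => /psi_index/(_ ln)/Cpsi[].
Qed.

Lemma wav_continuous w : Omega w -> continuous (wav phi psi w).
Proof.
case: w => -[l i] k O; rewrite (wav_atom O).
apply: continuous_cstM; apply: continuous_affine.
exact: CL_continuous (atom_CL (Omega_lt O)).
Qed.

Lemma phi_sqr_averaging_kernel : exists rho, averaging_kernel rho (fun x => phi x ^+ 2).
Proof.
have [K K0 cphi] := atom_Cc_ball (expn_gt0 2 n : (0 < 2 ^ n)%N).
exists K; split => [//||x|]; [exact: Cc_ballX2|exact: sqr_ge0|].
have w0 : Omega (0%N, 0%N, 0 : 'rV[int]_n) by left.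
have [_ _ _ /(_ _ _ w0 w0) + _] := dau; rewrite eqxx/= => <-.
have intv0 : intv R 0 = 0 :> pt by apply/rowP => i; rewrite !mxE.
by congr intRn; apply/funext => x; rewrite intv0 subr0 expr2.
Qed.

Lemma phi_sqr_CL : CL L (fun x => phi x ^+ 2).
Proof.
have Cphi := atom_CL (expn_gt0 2 n : (0 < 2 ^ n)%N).
by under eq_fun do rewrite expr2; exact: CLM.
Qed.

Lemma psi_vanishing_moments l : (0 < l)%N -> (l < 2 ^ n)%N ->
  vanishing_moments L (atom l).
Proof.
move=> l0 ln a /ltnW aL; rewrite /atom gtn_eqF//.
by have [_ _ /(_ l (psi_index l0 ln)) mom _ _] := dau; exact: mom.
Qed.

Lemma wcoef_rescale f l i k : continuous f -> Omega (l, i, k) ->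
  wcoef phi psi f (l, i, k) * amplitude i =
  intRn (fun y => f (2 ^- i *: y + 2 ^- i *: intv R k) * atom l y).
Proof.
move=> cf O; have [K K0 catom] := atom_Cc_ball (Omega_lt O).
have p2 : 0 < 2 ^+ i :> R by rewrite exprn_gt0.
pose G y := f (2 ^- i *: y + 2 ^- i *: intv R k) * atom l y.
have cG : Cc_ball K G by apply: Cc_ballMl => //; exact: continuous_affine.
have -> : wcoef phi psi f (l, i, k) =
    intRn (fun x => amplitude i * G (2 ^+ i *: x + - intv R k)).
  rewrite /wcoef (wav_atom O); congr intRn; apply/funext => x.
  by rewrite /G scalerDr scalerN subrK scalerA mulVf ?gt_eqF// scale1r mulrCA.
have cGa := Cc_ball_affine (- intv R k) (lt0r_neq0 p2) cG.
rewrite (intRnZ _ _ cGa); last by rewrite divr_ge0// addr_ge0.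
rewrite (intRn_affine _ K0 (lt0r_neq0 p2) cG) gtr0_norm// mulrAC amplitude_sqr mulrA.
by rewrite divff ?mul1r// expf_neq0// gt_eqF.
Qed.

Lemma wcoef_decay_scaling f : continuous f -> (exists B, forall x, `|f x| <= B) ->
  exists2 C, 0 <= C & forall k, `|wcoef phi psi f (0%N, 0%N, k)| <= C.
Proof.
move=> cf [B fB]; have [K K0 cphi] := atom_Cc_ball (expn_gt0 2 n : (0 < 2 ^ n)%N).
have [P P0 phiP] := Cc_ball_bounded (@balls_compact_rV R n) cphi.
exists ((2 * K) ^+ n * (B * P)) => [|k].
  by rewrite !mulr_ge0 ?exprn_ge0 ?mulr_ge0// (le_trans (normr_ge0 _) (fB 0)).
have O : Omega (0%N, 0%N, k) by left.
have := wcoef_rescale cf O; rewrite amplitude0 mulr1 => ->.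
apply: intRn_norm_le K0 _ _ => [|x]; last by rewrite normrM; exact: ler_pM.
by apply: Cc_ballMl => //; exact: continuous_affine.
Qed.

Lemma wcoef_decay_wavelet s f l : 0 < s -> s < L%:R -> in_Lambda s f ->
  (0 < l)%N -> (l < 2 ^ n)%N ->
  exists2 C, 0 <= C & forall i k, Omega (l, i, k) ->
    `|wcoef phi psi f (l, i, k)| * amplitude i <= C * (2 `^ s) ^- i.
Proof.
move=> s0 sL Lf l0 ln; have [cf [[B fB] _]] := Lf.
have [D D0 fD] := Lambda_sdiffn_le s0 Lf.
have [K K0 catom] := atom_Cc_ball ln.
have [rho kerth] := phi_sqr_averaging_kernel.
have [C C0 psC] := pairing_decay (Num.truncn s).+1 kerth phi_sqr_CL K0 catom
  (psi_vanishing_moments l0 ln) (ltW (powR2_gt1 s0)) (powR2_lt_exprn sL).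
exists (C * (D * (n%:R * rho) `^ s)) => [|i k O]; first by rewrite !mulr_ge0 ?powR_ge0.
rewrite -[amplitude i]ger0_norm ?(ltW (amplitude_gt0 i))// -normrM (wcoef_rescale cf O).
have <- : (2 ^- i) `^ s = (2 `^ s) ^- i by rewrite invr_powR ?exprn_gt0// exprn_powR.
rewrite -mulrA; apply: (psC _ _ B) => //; first exact: continuous_affine.
by apply: dyadic_sdiffn_le_affine => //; exact: ltW.
Qed.

Lemma wcoef_decay s f : 0 < s -> s < L%:R -> in_Lambda s f ->
  exists2 C, 0 <= C & forall l i k, Omega (l, i, k) ->
    `|wcoef phi psi f (l, i, k)| * amplitude i <= C * (2 `^ s) ^- i.
Proof.
move=> s0 sL Lf; have [cf [bf _]] := Lf.
have [C0 C00 phiC] := wcoef_decay_scaling cf bf.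
have /fin_all_exists2[C CP] : forall l : 'I_(2 ^ n), exists2 C, 0 <= C &
    (0 < l)%N -> forall i k, Omega (l : nat, i, k) ->
      `|wcoef phi psi f (l : nat, i, k)| * amplitude i <= C * (2 `^ s) ^- i.
  move=> l; have [l0|l0] := leqP l 0; first by exists 0.
  have := wcoef_decay_wavelet s0 sL Lf l0 (ltn_ord l).
  by move=> [C CP1 CP2]; exists C.
move=> psC; exists (C0 + \sum_l C l) => [|l i k O]; first by rewrite addr_ge0// sumr_ge0.
have sgi : 0 <= (2 `^ s) ^- i :> R by rewrite invr_ge0 exprn_ge0// powR_ge0.
have [l0|l0] := posnP l.
  move: O; rewrite l0 => /[dup] /Omega0 -> _; rewrite amplitude0 expr0 invr1 !mulr1.
  by apply: le_trans (phiC k) _; rewrite lerDl sumr_ge0.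
apply: le_trans (psC (Ordinal (Omega_lt O)) l0 i k O) _.
by rewrite ler_wpM2r// ler_wpDl// le_sum_term.
Qed.

End Wavelets.

Arguments amplitude {R} n i.

(** * Localisation by Parseval *)

Section Parseval.
Context {R : realType} {n : nat}.
Local Notation pt := 'rV[R]_n.
Implicit Types (K B : R) (f g T : pt -> R) (x z : pt) (w : windex n).

Definition Omega_sums_le (t : windex n -> R) B : Prop := forall F : seq (windex n),
  uniq F -> (forall w, w \in F -> Omega w) -> \sum_(w <- F) t w <= B.

Lemma esum_Omega_le t B : Omega_sums_le t B -> (\esum_(w in @Omega n) (t w)%:E <= B%:E)%E.
Proof.
move=> tB; apply: ub_ereal_sup => _ [A [fA AO] <-].
rewrite fsbig_finite//= sumEFin lee_fin; apply: tB; first exact: finmap.fset_uniq.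
by move=> w; rewrite in_fset_set// inE; exact: AO.
Qed.

Variables (L : nat) (phi : pt -> R) (psi : nat -> pt -> R).
Hypothesis dau : daubechies L phi psi.

Lemma wcoefB K g g' w : 0 <= K -> Cc_ball K g -> Cc_ball K g' -> Omega w ->
  wcoef phi psi (fun x => g x - g' x) w = wcoef phi psi g w - wcoef phi psi g' w.
Proof.
move=> K0 cg cg' /(wav_continuous dau) cw; rewrite /wcoef.
rewrite -(intRnB K0 (Cc_ballMr cg cw) (Cc_ballMr cg' cw)).
by under eq_fun do rewrite mulrBl.
Qed.

Lemma wcoefN K g w : 0 <= K -> Cc_ball K g -> Omega w ->
  wcoef phi psi (fun x => - g x) w = - wcoef phi psi g w.
Proof.
move=> K0 cg /(wav_continuous dau) cw; rewrite /wcoef.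
by rewrite -(intRnN K0 (Cc_ballMr cg cw)); under eq_fun do rewrite mulNr.
Qed.

Lemma parseval_sqr K g : 0 <= K -> Cc_ball K g ->
  (\esum_(w in @Omega n) (wcoef phi psi g w ^+ 2)%:E)%E = (intRn (fun x => g x ^+ 2))%:E.
Proof.
move=> K0 cg; have [_ _ _ _ parseval] := dau.
exact: parseval cg.1 (Cc_ball_compact_support K0 cg).
Qed.

Lemma parseval_le K g g' B : 0 <= K -> Cc_ball K g -> Cc_ball K g' ->
  Omega_sums_le (fun w => `|wcoef phi psi g w * wcoef phi psi g' w|) B ->
  intRn (fun x => g x * g' x) <= B.
Proof.
move=> K0 cg cg' sumB.
set a := wcoef phi psi g in sumB *; set b := wcoef phi psi g' in sumB *.
have cN := Cc_ballN cg'; have [cm cp] := (Cc_ballB cg cg', Cc_ballB cg cN).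
have coefm w : Omega w -> wcoef phi psi (fun x => g x - g' x) w = a w - b w.
  exact: wcoefB K0 cg cg'.
have coefp w : Omega w -> wcoef phi psi (fun x => g x - - g' x) w = a w + b w.
  by move=> O; rewrite (wcoefB K0 cg cN O) (wcoefN K0 cg' O) opprK.
have polar : intRn (fun x => (g x - - g' x) ^+ 2) <=
    intRn (fun x => (g x - g' x) ^+ 2) + 4 * B.
  rewrite -lee_fin EFinD EFinM -(parseval_sqr K0 cm) -(parseval_sqr K0 cp).
  apply: (@le_trans _ _ (\esum_(w in @Omega n)
     (((wcoef phi psi (fun x => g x - g' x) w) ^+ 2)%:E + (4 * `|a w * b w|)%:E))%E).
    apply: le_esum => w wO; rewrite -EFinD lee_fin (coefm w wO) (coefp w wO).
    have := ler_norm (a w * b w); lra.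
  rewrite esumD; last 2 first.
  - by move=> w _; rewrite lee_fin sqr_ge0.
  - by move=> w _; rewrite lee_fin mulr_ge0.
  apply: leeD => //; rewrite -EFinM; apply: esum_Omega_le => F uF FO.
  by rewrite -mulr_sumr ler_pM2l//; exact: sumB.
have cgg' := Cc_ballMl cg.1 cg'.
have intE : 4 * intRn (fun x => g x * g' x) =
    intRn (fun x => (g x - - g' x) ^+ 2) - intRn (fun x => (g x - g' x) ^+ 2).
  rewrite -(intRnB K0 (Cc_ballX2 cp) (Cc_ballX2 cm)) -(intRnZ 4 K0 cgg').
  by congr intRn; apply/funext => x; ring.
lra.
Qed.

Lemma parseval_norm_le K g g' B : 0 <= K -> Cc_ball K g -> Cc_ball K g' ->
  Omega_sums_le (fun w => `|wcoef phi psi g w * wcoef phi psi g' w|) B ->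
  `|intRn (fun x => g x * g' x)| <= B.
Proof.
move=> K0 cg cg' sumB; rewrite ler_norml; apply/andP; split; last first.
  exact: (parseval_le K0 cg cg' sumB).
rewrite lerNl -(intRnN K0 (Cc_ballMl cg.1 cg')).
under eq_fun do rewrite -mulNr.
apply: (parseval_le K0 (Cc_ballN cg) cg') => F uF FO.
apply: le_trans (sumB F uF FO); rewrite big_seq [leRHS]big_seq; apply: ler_sum => w wF.
by rewrite (wcoefN K0 cg (FO w wF)) mulNr normrN.
Qed.

Lemma atoms_Cc_ball : exists2 K, 0 <= K &
  forall l, (l < 2 ^ n)%N -> Cc_ball K (atom phi psi l).
Proof.
have /fin_all_exists2[K K0 cK] := fun l : 'I_(2 ^ n) => atom_Cc_ball dau (ltn_ord l).
exists (\sum_l K l) => [|l ln]; first exact: sumr_ge0.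
by apply: Cc_ballW (cK (Ordinal ln)); exact: le_sum_term.
Qed.

Lemma wav_support K w z : (forall l, (l < 2 ^ n)%N -> Cc_ball K (atom phi psi l)) ->
  Omega w -> wav phi psi w z != 0 -> `|2 ^+ w.1.2 *: z - intv R w.2| <= K.
Proof.
case: w => -[l i] k cK O; rewrite (wav_atom _ _ O)/= leNgt => nz; apply/negP => Kz.
by move: nz; rewrite (cK l (Omega_lt O)).2 ?mulr0 ?eqxx.
Qed.

Lemma wav_support_diam K w x z : (forall l, (l < 2 ^ n)%N -> Cc_ball K (atom phi psi l)) ->
  Omega w -> wav phi psi w x != 0 -> wav phi psi w z != 0 -> `|x - z| <= 2 * K.
Proof.
move=> cK O /(wav_support cK O) xw /(wav_support cK O) zw.
apply: (@le_trans _ _ `|2 ^+ w.1.2 *: (x - z)|).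
  rewrite normrZ ler_peMl// ger0_norm ?exprn_ge0//.
  by apply: exprn_ege1; rewrite ler1n.
rewrite scalerBr -(subrKA (intv R w.2)); apply: le_trans (ler_normD _ _) _.
by rewrite [`|intv _ _ - _|]distrC; lra.
Qed.

Lemma cutoff (rho : R) : 0 <= rho ->
  exists2 chi : pt -> R, Cc_ball (rho + 1) chi & forall z, `|z| <= rho -> chi z = 1.
Proof.
move=> rho0; pose chi z : R := Num.max 0 (1 - Num.max 0 (`|z| - rho)).
exists chi => [|z zr]; last first.
  rewrite /chi (_ : Num.max 0 (`|z| - rho) = 0) ?subr0; first by apply/max_idPr.
  by apply/max_idPl; rewrite subr_le0.
split => [|z rz]; last first.
  by apply/max_idPl; rewrite subr_le0 le_max; apply/orP; right; lra.
have cmax0 (F : pt -> R) : continuous F -> continuous (fun z => Num.max 0 (F z)).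
  by move=> cF z; exact: (continuous_max (@cst_continuous _ _ 0 z) (cF z)).
have cdist : continuous (fun z : pt => `|z| - rho).
  by move=> z; exact: (continuousB (@norm_continuous _ _ z) (@cst_continuous _ _ rho z)).
apply: (cmax0) => z.
exact: (continuousB (@cst_continuous _ _ (1 : R) z) (cmax0 _ cdist z)).
Qed.

(* Multiplying [f] by a cutoff changes none of its coefficients that meet the support of [T],
   so Parseval applies although [f] need not be square integrable. *)
Lemma parseval_local_le K f T B : 0 <= K -> continuous f -> Cc_ball K T ->
  Omega_sums_le (fun w => `|wcoef phi psi f w * wcoef phi psi T w|) B ->
  `|intRn (fun x => f x * T x)| <= B.
Proof.
move=> K0 cf cT sumB; have [A A0 cA] := atoms_Cc_ball.
pose rho := K + 2 * A; have rho0 : 0 <= rho by rewrite addr_ge0// mulr_ge0.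
have Krho : K <= rho by rewrite lerDl mulr_ge0.
have [chi cchi chi1] := cutoff rho0; pose g z := f z * chi z.
have -> : intRn (fun x => f x * T x) = intRn (fun x => g x * T x).
  congr intRn; apply/funext => z; rewrite /g.
  have [zK|zK] := leP `|z| K; last by rewrite cT.2// !mulr0.
  by rewrite chi1 ?mulr1// (le_trans zK).
have cT1 : Cc_ball (rho + 1) T by apply: Cc_ballW cT; lra.
apply: (parseval_norm_le _ (Cc_ballMl cf cchi) cT1); first by rewrite addr_ge0.
move=> F uF FO; apply: le_trans (sumB F uF FO).
rewrite big_seq [leRHS]big_seq; apply: ler_sum => w wF; have O := FO w wF.
have [->|nT] := eqVneq (wcoef phi psi T w) 0; first by rewrite !mulr0.
have [z0 z0T z0w] : exists2 z, `|z| <= K & wav phi psi w z != 0.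
  apply: contrapT => disjoint; move/eqP: nT; apply; rewrite /wcoef -(@intRn0 R n).
  congr intRn; apply/funext => z; have [zK|/cT.2 ->] := leP `|z| K; last by rewrite mul0r.
  have [->|wz] := eqVneq (wav phi psi w z) 0; first by rewrite mulr0.
  by case: disjoint; exists z.
suff -> : wcoef phi psi g w = wcoef phi psi f w by [].
congr intRn; apply/funext => z.
have [->|wz] := eqVneq (wav phi psi w z) 0; first by rewrite !mulr0.
rewrite /g chi1 ?mulr1//; have := wav_support_diam cA O wz z0w.
by have := ler_normD (z - z0) z0; rewrite subrK /rho; lra.
Qed.

Lemma weighted_sdiffn_le K f th h r B : 0 <= K -> continuous f -> Cc_ball K th ->
  (forall z, 0 <= th z) ->
  (forall z, th z != 0 ->
    Omega_sums_le (fun w => `|wcoef phi psi f w| * `|sdiffn r h (wav phi psi w) z|) B) ->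
  `|intRn (fun z => th z * sdiffn r h f z)| <= B * intRn th.
Proof.
move=> K0 cf cth th0 sumB; pose T := sdiffn r h th.
have <- : `|intRn (fun z => f z * T z)| = `|intRn (fun z => th z * sdiffn r h f z)|.
  by rewrite (intRn_sdiffn _ _ K0 cf cth) normrM normrX normrN1 expr1n mul1r.
have cT : Cc_ball (K + r%:R * `|h|) T by exact: Cc_ball_sdiffn.
apply: (parseval_local_le _ cf cT); first by rewrite addr_ge0 ?mulr_ge0.
move=> F uF FO.
pose t w z := th z * (`|wcoef phi psi f w| * `|sdiffn r h (wav phi psi w) z|).
have cw w : Omega w -> continuous (sdiffn r h (wav phi psi w)).
  by move=> /(wav_continuous dau); exact: sdiffn_continuous.
have cthw w : Omega w -> Cc_ball K (fun z => th z * `|sdiffn r h (wav phi psi w) z|).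
  move=> O; apply: Cc_ballMr => // z.
  by apply: (continuous_comp (cw w O z)); exact: norm_continuous.
have ct w : w \in F -> Cc_ball K (t w).
  by move=> /FO O; rewrite /t; under eq_fun do rewrite mulrCA; exact: Cc_ballZ (cthw w O).
apply: (@le_trans _ _ (\sum_(w <- F) intRn (t w))).
  rewrite big_seq [leRHS]big_seq; apply: ler_sum => w wF; have O := FO w wF.
  have -> : intRn (t w) = `|wcoef phi psi f w| *
      intRn (fun z => th z * `|sdiffn r h (wav phi psi w) z|).
    by rewrite -(intRnZ _ K0 (cthw w O)); under [in RHS]eq_fun do rewrite mulrCA.
  rewrite normrM ler_wpM2l// /wcoef; under eq_fun do rewrite mulrC.
  rewrite (intRn_sdiffn _ _ K0 (wav_continuous dau O) cth) normrM normrX normrN1.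
  rewrite expr1n mul1r; apply: le_trans (le_norm_intRn K0 (Cc_ballMr cth (cw w O))) _.
  by under eq_fun do rewrite normrM ger0_norm//.
rewrite -(intRn_sum K0 ct) -(intRnZ _ K0 cth).
apply: (intRn_le K0 (Cc_ball_sum ct) (Cc_ballZ _ cth)) => z; rewrite -mulr_sumr.
have [->|nz] := eqVneq (th z) 0; first by rewrite mul0r mulr0.
by rewrite mulrC ler_wpM2r//; exact: sumB.
Qed.

End Parseval.

Section Localisation.
Context {R : realType} {n : nat}.
Local Notation pt := 'rV[R]_n.
Implicit Types (B c d rho : R) (f S th : pt -> R) (x z h : pt) (r : nat).

Lemma norm_le_of_avg rho th S x B c : averaging_kernel rho th -> continuous S -> 0 < c ->
  (forall d, 0 < d <= c -> `|avg th d S x| <= B) -> `|S x| <= B.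
Proof.
move=> kerth cS c0 avgB_; have [rho0 cth _ th1] := kerth.
apply/ler_addgt0Pl => e e0.
have rho1 : 0 < rho + 1 by rewrite ltr_wpDl.
have [d' d'0 Sd'] := continuous_ball_unif (@balls_compact_rV R n) `|x| cS e0.
pose d := Num.min c (d' / (rho + 1)).
have d0 : 0 < d by rewrite lt_min c0 divr_gt0.
have dc : 0 < d <= c by rewrite d0 ge_min lexx.
have avg_cst : avg th d (fun=> S x) x = S x.
  by rewrite /avg; under eq_fun do rewrite mulrC; rewrite (intRnZ _ rho0 cth) th1 mulr1.
have near : `|S x - avg th d S x| <= e.
  rewrite -{1}avg_cst -(avgB kerth)//; last exact: cst_continuous.
  apply: (mean_norm_le kerth) => [|u urho].
    have cSa := continuous_affine d x cS.
    by move=> u; apply: continuousB; [exact: cst_continuous|exact: cSa].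
  apply: Sd' => //; rewrite opprD addrCA subrr addr0 normrN normrZ gtr0_norm//.
  apply: (@le_trans _ _ (d' / (rho + 1) * (rho + 1))); last by rewrite divfK// gt_eqF.
  by apply: ler_pM; rewrite ?(ltW d0) ?ge_min ?lexx ?orbT// (le_trans urho)// lerDl.
rewrite -(subrK (avg th d S x) (S x)); apply: le_trans (ler_normD _ _) _.
exact: lerD near (avgB_ d dc).
Qed.

Variables (L : nat) (phi : pt -> R) (psi : nat -> pt -> R).
Hypothesis dau : daubechies L phi psi.

Lemma sdiffn_le_wavelet_sum f x h r B c : continuous f -> 0 < c ->
  (forall z, `|x - z| <= c ->
    Omega_sums_le (fun w => `|wcoef phi psi f w| * `|sdiffn r h (wav phi psi w) z|) B) ->
  `|sdiffn r h f x| <= B.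
Proof.
move=> cf c0 sumB; have [rho kerth] := phi_sqr_averaging_kernel dau.
have [rho0 cth th0 th1] := kerth; set th := fun z => phi z ^+ 2 in kerth cth th0 th1.
have rho1 : 0 < rho + 1 by rewrite ltr_wpDl.
apply: (norm_le_of_avg kerth (c := c / (rho + 1))); first exact: sdiffn_continuous.
  by rewrite divr_gt0.
move=> d /andP[d0 dc]; pose S := sdiffn r h f.
pose w z := th (d^-1 *: z + - (d^-1 *: x)).
have dV0 : d^-1 != 0 by rewrite invr_eq0 gt_eqF.
have cw := Cc_ball_affine (- (d^-1 *: x)) dV0 cth; rewrite -/w in cw.
set K := (rho + _) / _ in cw; have K0 : 0 <= K by rewrite divr_ge0// addr_ge0.
have wE u : w (d *: u + x) = th u.
  by rewrite /w scalerDr scalerA mulVf ?gt_eqF// scale1r addrK.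
have cS : continuous S by exact: sdiffn_continuous.
have -> : avg th d S x = `|d| ^- n * intRn (fun z => w z * S z).
  rewrite -(intRn_affine x K0 _ (Cc_ballMr cw cS)) ?gt_eqF//.
  by congr intRn; apply/funext => u; rewrite wE.
have intw : `|d| ^- n * intRn w = 1.
  rewrite -(intRn_affine x K0 _ cw) ?gt_eqF// -th1.
  by congr intRn; apply/funext => u; rewrite wE.
rewrite normrM ger0_norm ?invr_ge0 ?exprn_ge0// -[leRHS]mulr1 -intw mulrCA.
rewrite ler_wpM2l ?invr_ge0 ?exprn_ge0//.
apply: (weighted_sdiffn_le dau K0 cf cw) => [z|z wz]; first exact: th0.
apply: sumB; rewrite distrC.
have : `|d^-1 *: (z - x)| <= rho.
  rewrite leNgt; apply/negP => far; move: wz.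
  by rewrite /w -scalerBr cth.2// eqxx.
rewrite normrZ gtr0_norm ?invr_gt0// mulrC ler_pdivrMr// => /le_trans; apply.
by apply: le_trans (ler_wpM2l rho0 dc) _; rewrite mul_div_addr1_le// ltW.
Qed.

End Localisation.

(** * Sums over scales *)

Section ScaleSums.
Context {R : realType}.
Implicit Types (q b D sg tau : R) (i j m p : nat).

Definition sdist i j : nat := (i - j + (j - i))%N.

Lemma sdist_leP i j m : (sdist i j <= m)%N -> (i <= j + m)%N /\ (j <= i + m)%N.
Proof.
by move=> ijm; split; rewrite -leq_subLR; apply: leq_trans ijm;
  rewrite ?leq_addr ?leq_addl.
Qed.

Lemma sum_sdist_le q I j : 0 < q -> q < 1 ->
  \sum_(i < I) q ^+ sdist i j <= 2 / (1 - q).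
Proof.
move=> q0 q1; have qge0 := ltW q0; rewrite -(big_mkord predT (fun i => q ^+ sdist i j)).
apply: (@le_trans _ _ (\sum_(0 <= i < j + I) q ^+ sdist i j)).
  rewrite (@big_cat_nat _ _ _ I 0 (j + I))//= ?leq_addl//.
  by rewrite lerDl sumr_ge0// => i _; rewrite exprn_ge0.
rewrite (@big_cat_nat _ _ _ j 0 (j + I))//= ?leq_addr// mulr_natl mulr2n.
apply: lerD.
  rewrite big_mkord (reindex_inj rev_ord_inj)/=.
  apply: le_trans (sum_geometric_le j q0 q1); apply: ler_sum => i _.
  rewrite /sdist (eqP (leq_subr _ _ : (j - i.+1 <= j)%N)) add0n subKn//.
  by rewrite exprS ler_piMl ?exprn_ge0// ltW.
rewrite -{1}[j]add0n big_addn addKn big_mkord.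
apply: le_trans (sum_geometric_le I q0 q1); apply: ler_sum => i _.
by rewrite /sdist addnK (eqP (leq_addl i j : (j - (i + j) == 0)%N)) addn0.
Qed.

Lemma sum_by_scale_le (T : eqType) (F : seq T) (scale : T -> nat) (t : T -> R)
    (v : nat -> R) (N : nat) (V : R) :
  (forall i, (count (fun w => (scale w == i) && (t w != 0)%R) F <= N)%N) ->
  (forall w, w \in F -> t w <= v (scale w)) -> (forall i, 0 <= v i) ->
  (forall I, \sum_(i < I) v i <= V) ->
  \sum_(w <- F) t w <= N%:R * V.
Proof.
move=> countN tv v0 vV; pose I := (\max_(w <- F) scale w).+1.
have scaleI w : w \in F -> (scale w < I)%N.
  by move=> wF; rewrite ltnS; exact: (@leq_bigmax_seq _ _ xpredT scale).
apply: le_trans (ler_wpM2l (ler0n _ N) (vV I)); rewrite mulr_sumr.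
apply: (@le_trans _ _ (\sum_(i < I) \sum_(w <- F) (if scale w == i then t w else 0))).
  rewrite exchange_big/= big_seq [leRHS]big_seq; apply: ler_sum => w wF.
  rewrite (bigD1 (Ordinal (scaleI w wF)))//= eqxx big1 ?addr0// => i /negPf iw.
  by rewrite ifF//; apply/negbTE; move: iw; rewrite eq_sym => /negbT.
apply: ler_sum => i _.
apply: (@le_trans _ _ (\sum_(w <- F) (if (scale w == i) && (t w != 0) then v i else 0))).
  rewrite big_seq [leRHS]big_seq; apply: ler_sum => w wF.
  have [<-|//] := eqVneq (scale w) i; rewrite /=.
  by have [->//|_] := eqVneq (t w) 0; exact: tv.
rewrite -big_mkcond/= big_const_seq iter_addr_0 -[_ *+ count _ _]mulr_natl.
by rewrite ler_wpM2r// ler_nat.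
Qed.

(* The bound [b <= D] is used for scales finer than [j], the other one for coarser scales. *)
Lemma scale_decay_le sg tau b D i j p : 0 < sg -> sg^-1 <= tau -> sg / 2 ^+ p <= tau ->
  0 <= b -> b <= D -> b <= D * (2 ^+ i * 2 ^- j) ^+ p ->
  sg ^- i * b <= D * sg ^- j * tau ^+ sdist i j.
Proof.
move=> sg0 sgtau sgptau b0 bD bDp; have D0 : 0 <= D by exact: le_trans bD.
have sgV t : 0 <= sg ^- t by rewrite invr_ge0 exprn_ge0// ltW.
have tau0 : 0 <= tau by apply: le_trans sgtau; rewrite invr_ge0 ltW.
rewrite /sdist; have [ji|/ltnW ij] := leqP j i.
  rewrite (eqP ji) addn0 (_ : sg ^- i = sg ^- j * sg^-1 ^+ (i - j)); last first.
    by rewrite exprVn -invfM -exprD subnKC.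
  rewrite mulrAC; apply: ler_pM; [exact: mulr_ge0| |by rewrite mulrC ler_wpM2r|].
    by rewrite exprn_ge0// invr_ge0 ltW.
  by rewrite lerXn2r ?nnegrE ?invr_ge0 ?(ltW sg0).
rewrite (eqP ij) add0n; apply: le_trans (ler_wpM2l (sgV i) bDp) _.
rewrite mulrCA -[leRHS]mulrA ler_wpM2l//.
have -> : 2 ^+ i * 2 ^- j = 2 ^- (j - i) :> R.
  by rewrite -[in LHS](subnKC ij) exprD invfM mulrA divff ?mul1r// expf_neq0// pnatr_eq0.
have -> : sg ^- i = sg ^- j * sg ^+ (j - i).
  by rewrite -{1}(subnKC ij) exprD invfM mulfVK// expf_neq0// gt_eqF.
rewrite -mulrA ler_wpM2l// exprVn -exprM mulnC exprM -expr_div_n.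
by rewrite lerXn2r ?nnegrE ?divr_ge0 ?exprn_ge0 ?(ltW sg0).
Qed.

Lemma far_weight_le q (a C : R) d m : 0 <= q -> q <= 1 -> 0 <= a -> 0 <= C ->
  (if (d <= m)%N then a else C) * (q * q) ^+ d <= (a + C * q ^+ m) * q ^+ d.
Proof.
move=> q0 q1 a0 C0; have qX t : 0 <= q ^+ t by exact: exprn_ge0.
rewrite exprMn mulrA ler_wpM2r//; case: leqP => [_|/ltnW md].
  rewrite (@le_trans _ _ a)// ?ler_piMr// ?exprn_ile1//.
  by rewrite lerDl mulr_ge0.
by rewrite ler_wpDl// ler_wpM2l// ler_wiXn2l.
Qed.

Lemma exists_scale_ratio (s : R) p : 0 < s -> s < p%:R -> exists q : R,
  [/\ 0 < q, q < 1, (2 `^ s)^-1 <= q * q & 2 `^ s / 2 ^+ p <= q * q].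
Proof.
move=> s0 sp; have sg1 := powR2_gt1 s0; have sg0 := lt_trans ltr01 sg1.
pose tau := Num.max (2 `^ s / 2 ^+ p) (2 `^ s)^-1.
have tau0 : 0 < tau by rewrite lt_max invr_gt0 sg0 orbT.
have qq : Num.sqrt tau * Num.sqrt tau = tau by rewrite -expr2 sqr_sqrtr// ltW.
exists (Num.sqrt tau); rewrite qq; split.
- by rewrite sqrtr_gt0.
- rewrite -sqrtr1 ltr_sqrt// gt_max invf_lt1// sg1 andbT.
  by rewrite ltr_pdivrMr ?exprn_gt0// mul1r powR2_lt_exprn.
- by rewrite le_max lexx orbT.
- by rewrite le_max lexx.
Qed.

Lemma threshold_choice q sg (Z : R) : 0 <= q -> q < 1 -> 1 < sg -> 0 <= Z ->
  exists2 c, 0 < c < 1 & forall C eps : R, 0 <= C -> 0 < eps ->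
    exists m, Z * (c * eps + C * q ^+ m) <= eps / sg.
Proof.
move=> q0 q1 sg1 Z0; have sg0 := lt_trans ltr01 sg1.
have Z1 : 0 < Z + 1 by rewrite ltr_wpDl.
exists (2 * sg * (Z + 1))^-1 => [|C eps C0 eps0].
  have : 1 <= sg * (Z + 1) by rewrite mulr_ege1 ?(ltW sg1)// lerDr.
  by rewrite invr_gt0 invf_lt1 ?mulr_gt0//= -mulrA; lra.
have ZC1 : 0 < Z * C + 1 by rewrite ltr_wpDl// mulr_ge0.
have half0 : 0 <= eps / sg / 2 by rewrite !divr_ge0// ltW.
have [|m qm] := @exprn_small R q (eps / (2 * sg * (Z * C + 1))) q0 q1.
  by rewrite divr_gt0// !mulr_gt0.
exists m; rewrite mulrDr [leRHS]splitr; apply: lerD.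
  have -> : Z * ((2 * sg * (Z + 1))^-1 * eps) = Z * (eps / sg / 2 / (Z + 1)).
    by field; rewrite !gt_eqF.
  exact: mul_div_addr1_le.
rewrite mulrA; apply: le_trans (ler_wpM2l (mulr_ge0 Z0 C0) qm) _.
have -> : Z * C * (eps / (2 * sg * (Z * C + 1))) = Z * C * (eps / sg / 2 / (Z * C + 1)).
  by field; rewrite !gt_eqF.
by rewrite mul_div_addr1_le// mulr_ge0.
Qed.

End ScaleSums.

(** * Hyperbolic distance to the cubes *)

Section Hyperbolic.
Context {R : realType} {n : nat}.
Local Notation pt := 'rV[R]_n.

Lemma arccosh_lt (t H : R) : 1 <= t -> t <= 1 + H -> arccosh t < 2 * (1 + H) + 1.
Proof.
move=> t1 tH; rewrite /arccosh; set u := Num.sqrt _.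
have u0 : 0 <= u by exact: sqrtr_ge0.
have ut : u <= t.
  rewrite -[leRHS]ger0_norm; last by lra.
  by rewrite -sqrtr_sqr; apply: ler_wsqrtr; lra.
have : ln (t + u) <= t + u - 1.
  by have := @le_ln1Dx R (t + u - 1); rewrite subrKC; apply; lra.
by lra.
Qed.

Definition hrho_bound (A B : R) : R := 2 * (1 + (n%:R * A ^+ 2 + 1) * (1 + B) ^+ 2) + 1.

Lemma hrho_bound_gt1 A B : 1 < hrho_bound A B.
Proof.
have := mulr_ge0 (addr_ge0 (mulr_ge0 (ler0n R n) (sqr_ge0 A)) ler01) (sqr_ge0 (1 + B)).
by rewrite /hrho_bound; lra.
Qed.

Lemma hrho_lt (X Y : pt * R) (A B : R) : 0 <= A -> 0 < X.2 -> 0 < Y.2 ->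
  X.2 <= B * Y.2 -> Y.2 <= B * X.2 -> `|X.1 - Y.1| <= A * (X.2 + Y.2) ->
  hrho X Y < hrho_bound A B.
Proof.
case: X Y => [x a] [y b] /= A0 a0 b0 ab ba xy.
have den : 0 < 2 * a * b by rewrite !mulr_gt0.
have Q0 : 0 <= n%:R * A ^+ 2 + 1 by rewrite addr_ge0// mulr_ge0// sqr_ge0.
have S0 : 0 <= a + b by rewrite addr_ge0// ltW.
apply: arccosh_lt => /=.
  by rewrite lerDl divr_ge0 ?(ltW den)// addr_ge0// sqr_ge0.
rewrite lerD2l ler_pdivrMr//.
apply: (@le_trans _ _ ((n%:R * A ^+ 2 + 1) * (a + b) ^+ 2)).
  rewrite mulrDl mul1r; apply: lerD.
    apply: le_trans (enorm_sqr_le _) _; rewrite -mulrA ler_wpM2l// -exprMn.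
    by rewrite lerXn2r ?nnegrE ?mulr_ge0.
  have : 0 <= a * b by rewrite mulr_ge0// ltW.
  by rewrite sqrrB sqrrD; lra.
rewrite -[leRHS]mulrA ler_wpM2l//.
have lea : a + b <= (1 + B) * a by rewrite mulrDl mul1r lerD2l.
have leb : a + b <= (1 + B) * b by rewrite mulrDl mul1r addrC lerD2l.
rewrite expr2; apply: le_trans (ler_pM S0 S0 lea leb) _.
rewrite mulrACA -expr2 ler_wpM2l ?sqr_ge0//.
by rewrite -[leLHS]mul1r -mulrA ler_wpM2r ?mulr_ge0 ?(ltW a0) ?(ltW b0)// ler1n.
Qed.

Lemma corner_Tbox i (k : 'rV[int]_n) : Tbox i k (2 ^- i *: intv R k, 2 ^- i).
Proof.
have p2 : 0 < 2 ^+ i :> R by rewrite exprn_gt0.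
split => /=; last first.
  by rewrite lexx andbT ltr_pdivrMr// ltr_pMr ?invr_gt0// ltr1n.
by move=> c; rewrite !mxE mulrA divff ?gt_eqF// mul1r lexx/= ltrDl.
Qed.

End Hyperbolic.

Arguments hrho_bound {R} n A B.

(** * Differences and the coefficients of nearby cubes *)

Lemma near_floor_bounds (R : realType) (K t : R) (z : int) (M : nat) :
  K + 1 < M%:R -> `|t - z%:~R| <= K -> 0 <= z - Num.floor t + M%:Z <= (M.*2)%:Z.
Proof.
move=> KM; rewrite ler_norml => /andP[tz1 tz2].
have fl1 := floor_le t; have fl2 := floorD1_gt t; rewrite intrD1 in fl2.
have ME : (M%:Z)%:~R = M%:R :> R by [].
rewrite -(ler0z R) -(ler_int R) -addnn PoszD !rmorphD rmorphN/= !ME.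
by apply/andP; split; lra.
Qed.

Section NearbyCubes.
Context {R : realType} {n : nat}.
Local Notation pt := 'rV[R]_n.
Implicit Types (K c d : R) (x h z : pt) (f : pt -> R) (w : windex n).
Implicit Types (l i j m r : nat) (k : 'rV[int]_n).
Variables (L : nat) (phi : pt -> R) (psi : nat -> pt -> R).
Hypothesis dau : daubechies L phi psi.

Lemma sdiffn_atom_le r : exists2 D, 0 <= D & forall l, (l < 2 ^ n)%N ->
  forall h x, `|sdiffn r h (atom phi psi l) x| <= D /\
    `|sdiffn r h (atom phi psi l) x| <= D * `|h| ^+ minn r L.
Proof.
have /fin_all_exists2[D D0 atomD] : forall l : 'I_(2 ^ n), exists2 D, 0 <= D &
    forall h x, `|sdiffn r h (atom phi psi l) x| <= D /\
      `|sdiffn r h (atom phi psi l) x| <= D * `|h| ^+ minn r L.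
  move=> l; have [K K0 cK] := atom_Cc_ball dau (ltn_ord l).
  have [B B0 atomB] := Cc_ball_bounded (@balls_compact_rV R n) cK.
  have [C C0 atomC] := sdiffn_smooth_le (CL_le (geq_minr r L) (atom_CL dau (ltn_ord l))) cK.
  have [rB0 rC0] : 0 <= 2 ^+ r * B /\ 0 <= 2 ^+ (r - minn r L) * C.
    by split; rewrite mulr_ge0// exprn_ge0.
  exists (2 ^+ r * B + 2 ^+ (r - minn r L) * C) => [|h x]; first by rewrite addr_ge0.
  split; first by apply: le_trans (sdiffn_norm_le r h atomB x) _; rewrite lerDl.
  rewrite -{1}(subnK (geq_minl r L)) sdiffnD.
  apply: le_trans (sdiffn_norm_le _ _ (atomC h) x) _.
  by rewrite mulrA ler_wpM2r ?exprn_ge0// lerDr.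
exists (\sum_l D l) => [|l ln h x]; first exact: sumr_ge0.
have DS : D (Ordinal ln) <= \sum_l D l by exact: le_sum_term.
have [normD powD] := atomD (Ordinal ln) h x; split; first exact: le_trans DS.
by apply: le_trans powD _; rewrite ler_wpM2r// exprn_ge0.
Qed.

Lemma sdiffn_wav_le r sg tau : 0 < sg -> sg^-1 <= tau -> sg / 2 ^+ minn r L <= tau ->
  exists2 D, 0 <= D & forall l i j k h x, Omega (l, i, k) -> `|h| <= 2 ^- j ->
    sg ^- i * `|sdiffn r h (wav phi psi (l, i, k)) x| <=
    amplitude n i * (D * sg ^- j * tau ^+ sdist i j).
Proof.
move=> sg0 sgtau sgptau; have [D D0 atomD] := sdiffn_atom_le r.
exists D => // l i j k h x O hj.
rewrite (wav_atom _ _ O) sdiffnZ sdiffn_affine normrM ger0_norm ?(ltW (amplitude_gt0 i))//.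
rewrite mulrCA ler_wpM2l ?(ltW (amplitude_gt0 i))//.
have [normD powD] := atomD l (Omega_lt O) (2 ^+ i *: h) (2 ^+ i *: x + - intv R k).
apply: scale_decay_le sg0 sgtau sgptau _ normD _ => //.
apply: le_trans powD _; rewrite ler_wpM2l// lerXn2r ?nnegrE ?mulr_ge0 ?invr_ge0 ?exprn_ge0//.
by rewrite normrZ ger0_norm ?exprn_ge0// ler_wpM2l// exprn_ge0.
Qed.

Definition meets r h x c w : Prop :=
  exists2 z, `|x - z| <= c & sdiffn r h (wav phi psi w) z != 0.

Variable K : R.
Hypotheses (K0 : 0 <= K) (cK : forall l, (l < 2 ^ n)%N -> Cc_ball K (atom phi psi l)).

Lemma sdiffn_wav_support r h z w : Omega w -> sdiffn r h (wav phi psi w) z != 0 ->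
  exists p : 'I_r.+1, `|2 ^+ w.1.2 *: stencil r h z p - intv R w.2| <= K.
Proof. by move=> O /sdiffn_neq0[p nz]; exists p; exact: wav_support cK O nz. Qed.

Lemma meets_dist r h x l i j k : Omega (l, i, k) -> `|h| <= 2 ^- j ->
  meets r h x (2 ^- j) (l, i, k) ->
  `|x - 2 ^- i *: intv R k| <= (1 + r%:R) * 2 ^- j + K * 2 ^- i.
Proof.
move=> O hj [z xz /(sdiffn_wav_support O)[p /= pK]].
have p2 : 0 < 2 ^+ i :> R by rewrite exprn_gt0.
have zK : `|stencil r h z p - 2 ^- i *: intv R k| <= K * 2 ^- i.
  rewrite ler_pdivlMr// mulrC -{1}(gtr0_norm p2) -normrZ scalerBr scalerA.
  by rewrite divff ?gt_eqF// scale1r.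
have zp : `|z - stencil r h z p| <= r%:R * 2 ^- j.
  by rewrite distrC; apply: le_trans (stencil_dist h z p) _; rewrite ler_wpM2l.
have -> : x - 2 ^- i *: intv R k =
    (x - z) + ((z - stencil r h z p) + (stencil r h z p - 2 ^- i *: intv R k)).
  by rewrite !subrKA.
rewrite mulrDl mul1r -[leRHS]addrA; apply: le_trans (ler_normD _ _) _; apply: lerD => //.
by apply: le_trans (ler_normD _ _) _; exact: lerD.
Qed.

(* For fixed scale and position, the relevant cubes have their index within [K] of one of
   the [r.+1] rescaled stencil points. *)
Lemma count_wav_le r : exists N : nat, forall (F : seq (windex n)) i h z, uniq F ->
  (forall w, w \in F -> Omega w) ->
  (count (fun w => (w.1.2 == i) && (sdiffn r h (wav phi psi w) z != 0)%R) F <= N)%N.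
Proof.
pose M := (Num.truncn K).+2.
pose T := ('I_r.+1 * 'I_(2 ^ n) * {ffun 'I_n -> 'I_(M.*2).+1})%type.
exists #|{: T}| => F i h z uF FO.
pose X (p : 'I_r.+1) : pt := 2 ^+ i *: stencil r h z p.
pose G (a : T) : windex n := (a.1.2 : nat, i,
  \row_(c < n) (Num.floor (X a.1.1 ord0 c) + (a.2 c : nat)%:Z - M%:Z)).
rewrite -size_filter -(size_codom G); apply: uniq_leq_size; first exact: filter_uniq.
move=> [[l i'] k]; rewrite mem_filter/= => /andP[/andP[/eqP -> nz] /FO O].
have [p /= pK] := sdiffn_wav_support O nz.
pose u (c : 'I_n) := k ord0 c - Num.floor (X p ord0 c) + M%:Z.
have uM (c : 'I_n) : 0 <= u c <= (M.*2)%:Z.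
  apply: (near_floor_bounds (K := K)); first by rewrite /M -natr1 ltrD2r truncnS_gt.
  have := coord_norm_le (X p - intv R k) c; rewrite [X in `|X|]mxE [X in _ + X]mxE.
  by rewrite [X in - X]mxE => /le_trans; apply.
apply/codomP; exists (p, Ordinal (Omega_lt O), [ffun c => inord `|u c|%N]).
congr (_, _, _); apply/rowP => c; rewrite [RHS]mxE ffunE/=.
have /andP[u0 uM'] := uM c.
rewrite inordK; last by rewrite ltnS -lez_nat gez0_abs.
by rewrite gez0_abs// /u; ring.
Qed.

Lemma meets_hnbhd r h x y l i j k m s f c : (0 < n)%N -> Omega (l, i, k) ->
  `|h| <= 2 ^- j -> 2 ^- j.+1 < y <= 2 ^- j -> (sdist i j <= m)%N ->
  meets r h x (2 ^- j) (l, i, k) ->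
  c * (2 `^ s) ^- i < `|wcoef phi psi f (l, i, k)| * amplitude n i ->
  hnbhd (T0 phi psi i%:Z s f c) (hrho_bound n (2 * (1 + r%:R) + K) (2 ^+ m.+1)) (x, y).
Proof.
move=> n0 O hj /andP[y1 y2] ijm xw big.
have p2 t : 0 < 2 ^+ t :> R by rewrite exprn_gt0.
have y0 : 0 < y by apply: lt_trans y1; rewrite invr_gt0.
have yj : 2 ^- j < 2 * y.
  by move: y1; rewrite exprS invfM ltr_pdivrMl.
split => //=; exists (2 ^- i *: intv R k, 2 ^- i).
  exists k; last exact: corner_Tbox.
  exists l; split => //; rewrite -(ltr_pM2r (@amplitude_gt0 R n i)) -mulrA.
  by rewrite amplitudeM_powR.
have ratio (a b : nat) : (a <= b + m)%N -> 2 ^- b <= 2 ^+ m * 2 ^- a :> R.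
  move=> abm; rewrite -ler_pdivrMl// -invfM -exprD lef_pV2 ?posrE//.
  by rewrite ler_weXn2l ?ler1n// addnC.
have [ij ji] := sdist_leP ijm.
have ratji := ratio _ _ ij; have ratij := ratio _ _ ji.
apply: hrho_lt => //=; rewrite ?invr_gt0//.
- by rewrite addr_ge0// mulr_ge0// addr_ge0.
- rewrite exprS; apply: le_trans y2 _; apply: le_trans ratji _.
  by rewrite ler_wpM2r ?invr_ge0 ?(ltW (p2 _))// ler_peMl ?(ltW (p2 _))// ler1n.
- apply: le_trans ratij _; rewrite exprSr -mulrA ler_wpM2l ?(ltW (p2 _))//.
  exact: ltW.
apply: le_trans (meets_dist O hj xw) _.
have r0 : 0 <= 1 + r%:R :> R by rewrite addr_ge0.
have := ler_wpM2l r0 (ltW yj); have := mulr_ge0 K0 (ltW y0).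
have i0 : 0 <= 2 ^- i :> R by rewrite invr_ge0 ltW.
have := mulr_ge0 r0 i0; rewrite !mulrDl !mulrDr; lra.
Qed.

Lemma wcoef_sdiffn_wav_le f sg q D C a r h x z j m l i k :
  0 < sg -> 0 <= q <= 1 -> 0 <= D -> 0 <= C -> 0 <= a -> Omega (l, i, k) ->
  `|x - z| <= 2 ^- j ->
  sg ^- i * `|sdiffn r h (wav phi psi (l, i, k)) z| <=
    amplitude n i * (D * sg ^- j * (q * q) ^+ sdist i j) ->
  `|wcoef phi psi f (l, i, k)| * amplitude n i <= C * sg ^- i ->
  ((sdist i j <= m)%N -> meets r h x (2 ^- j) (l, i, k) ->
    `|wcoef phi psi f (l, i, k)| * amplitude n i <= a * sg ^- i) ->
  `|wcoef phi psi f (l, i, k)| * `|sdiffn r h (wav phi psi (l, i, k)) z| <=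
    D * sg ^- j * (a + C * q ^+ m) * q ^+ sdist i j.
Proof.
move=> sg0 /andP[q0 q1] D0 C0 a0 O xz wavD decay near.
have Dsg0 : 0 <= D * sg ^- j by rewrite mulr_ge0// invr_ge0 exprn_ge0// ltW.
have [->|nz] := eqVneq (sdiffn r h (wav phi psi (l, i, k)) z) 0.
  by rewrite normr0 mulr0 mulr_ge0 ?exprn_ge0// mulr_ge0// addr_ge0// mulr_ge0// exprn_ge0.
pose e := if (sdist i j <= m)%N then a else C.
have e0 : 0 <= e by rewrite /e; case: ifP.
have coef_le : `|wcoef phi psi f (l, i, k)| * amplitude n i <= e * sg ^- i.
  by rewrite /e; case: ifP => // ijm; apply: near => //; exists z.
have amp0 := @amplitude_gt0 R n i; rewrite -(ler_pM2r amp0) mulrAC.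
apply: le_trans (ler_wpM2r (normr_ge0 _) coef_le) _.
rewrite -[leLHS]mulrA; apply: le_trans (ler_wpM2l e0 wavD) _.
rewrite [leLHS](_ : _ = D * sg ^- j * (e * (q * q) ^+ sdist i j) * amplitude n i).
  rewrite ler_wpM2r ?(ltW amp0)// -[leRHS]mulrA ler_wpM2l//.
  exact: far_weight_le.
by ring.
Qed.

Lemma sdiffn_le_nearby_coefs r s : 0 < s -> s < r%:R -> s < L%:R ->
  exists2 q, 0 <= q < 1 & exists2 Z, 0 <= Z & forall f C a j m h x,
    continuous f -> 0 <= C -> 0 <= a -> `|h| <= 2 ^- j ->
    (forall l i k, Omega (l, i, k) ->
      `|wcoef phi psi f (l, i, k)| * amplitude n i <= C * (2 `^ s) ^- i) ->
    (forall l i k, Omega (l, i, k) -> (sdist i j <= m)%N ->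
      meets r h x (2 ^- j) (l, i, k) ->
      `|wcoef phi psi f (l, i, k)| * amplitude n i <= a * (2 `^ s) ^- i) ->
    `|sdiffn r h f x| <= Z * (a + C * q ^+ m) * (2 `^ s) ^- j.
Proof.
move=> s0 sr sL; have sg0 := powR_gt0 s (ltr0n R 2 : 0 < 2 :> R).
have sp : s < (minn r L)%:R by rewrite /minn; case: ifP.
have [q [q0 q1 sgq sgpq]] := exists_scale_ratio s0 sp.
exists q; first by rewrite q1 ltW.
have [D D0 wavD] := sdiffn_wav_le sg0 sgq sgpq.
have [N countN] := count_wav_le r.
exists (N%:R * (D * (2 / (1 - q)))) => [|f C a j m h x cf C0 a0 hj decay near].
  by rewrite !mulr_ge0// invr_ge0 subr_ge0 ltW.
pose v i := D * (2 `^ s) ^- j * (a + C * q ^+ m) * q ^+ sdist i j.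
have v0 i : 0 <= v i.
  by rewrite !mulr_ge0 ?addr_ge0 ?mulr_ge0 ?invr_ge0 ?exprn_ge0 ?(ltW q0) ?(ltW sg0).
apply: (sdiffn_le_wavelet_sum dau (c := 2 ^- j)) => // z xz F uF FO.
rewrite (_ : _ * _ * _ = N%:R * (D * (2 `^ s) ^- j * (a + C * q ^+ m) * (2 / (1 - q)))).
  apply: (@sum_by_scale_le _ _ F (fun w => w.1.2) _ v) => [i|[[l i] k] wF|//|I].
  - apply: leq_trans (countN F i h z uF FO); apply: sub_count => w /= /andP[-> /=].
    by rewrite mulf_eq0 negb_or !normr_eq0 => /andP[].
  - have O := FO _ wF; apply: (wcoef_sdiffn_wav_le sg0 _ D0 C0 a0 O xz).
    + by rewrite !ltW.
    + exact: wavD.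
    + exact: decay.
    + exact: near.
  - rewrite /v -mulr_sumr ler_wpM2l ?sum_sdist_le//.
    by have := v0 j; rewrite /v /sdist subnn expr0 mulr1.
by ring.
Qed.

End NearbyCubes.

Theorem mainTheorem10 (R : realType) (n : nat) (L : nat)
    (phi : 'rV[R]_n -> R) (psi : nat -> 'rV[R]_n -> R) (s : R) (r : nat) :
  (0 < n)%N -> daubechies L phi psi ->
  0 < s -> s < r%:R -> (r <= L.+1)%N -> s < L%:R ->
  exists c : R, 0 < c < 1 /\
    forall (f : 'rV[R]_n -> R) (eps : R), 0 < eps -> in_Lambda s f ->
    exists (m : nat) (Rr : R), 1 < Rr /\
      forall j : nat,
        Sset r j s f eps `<=`
        \bigcup_(i in [set i : int | j%:Z - m%:Z <= i <= j%:Z + m%:Z])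
           hnbhd (T0 phi psi i s f (c * eps)) Rr.
Proof.
move=> n0 dau s0 sr _ sL; have sg1 := powR2_gt1 s0.
have [K K0 cK] := atoms_Cc_ball dau.
have [q /andP[q0 q1] [Z Z0 sdiff_le]] := sdiffn_le_nearby_coefs dau cK s0 sr sL.
have [c c01 mP] := threshold_choice q0 q1 sg1 Z0.
exists c; split => // f eps eps0 Lf; have [cf _] := Lf.
have [C C0 decay] := wcoef_decay dau s0 sL Lf; have [m small_m] := mP C eps C0 eps0.
exists m, (hrho_bound n (2 * (1 + r%:R) + K) (2 ^+ m.+1)).
split=> [|j [x y] [/= y0 [+ yj]]]; first exact: hrho_bound_gt1.
rewrite ltr_pdivlMr ?powR_gt0// => eps_lt_Delta.
have [h hy eps_lt] := DeltaR_gt (mulr_ge0 (ltW eps0) (powR_ge0 _ _)) eps_lt_Delta.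
have hj : `|h| <= 2 ^- j.
  by apply: le_trans (norm_le_enorm h) _; rewrite hy; case/andP: yj.
have c0 : 0 <= c * eps by case/andP: c01 => c0 _; rewrite mulr_ge0 ?ltW.
apply: contrapT => uncovered; move: eps_lt; apply/negP; rewrite -leNgt.
apply: le_trans (sdiff_le f C (c * eps) j m h x cf C0 c0 hj decay _) _.
  move=> l i k O ijm xw; rewrite leNgt; apply/negP => big; apply: uncovered.
  exists i%:Z; last exact: (meets_hnbhd K0 cK n0 O hj yj ijm xw big).
  by have [ij ji] := sdist_leP ijm; rewrite /= lerBlDr -!PoszD !lez_nat ij ji.
apply: le_trans (ler_wpM2r _ small_m) _; first by rewrite invr_ge0 exprn_ge0 ?powR_ge0.
rewrite -mulrA ler_wpM2l ?(ltW eps0)// -invfM -exprS -exprn_powR// -invr_powR ?exprn_gt0//.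
case/andP: yj => /ltW yj _.
by apply: ge0_ler_powR; rewrite ?nnegrE ?invr_ge0 ?exprn_ge0 ?(ltW y0) ?(ltW s0).
Qed.
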